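(* Let $S$ be a smooth hypersurface in $\mathbb{R}^3$ satisfying the transversality assumption: for every $x\in S$ the affine tangent plane $x+T_xS$ does not pass through the origin. Let $\rho\in C_0^\infty(S)$ be non-negative, and assume that the maximal operator $$\mathcal{M}f(x):=\sup_{t>0}\Big|\int_S f(x-ty)\,\rho(y)\,d\sigma(y)\Big|,\qquad x\in\mathbb{R}^3,$$ is bounded on $L^p(\mathbb{R}^3)$. Then, for every point $x^0\in S$ at which $h(x^0,S)<2$ and $\rho(x^0)\neq 0$, we necessarily have $p>h(x^0,S)$.
   Context: Here $d\sigma$ is the surface measure on $S$. Local normalization: given $x^0\in S$, by the transversality assumption there is a linear change of coordinates of $\mathbb{R}^3$ after which $x^0=(0,0,1)$ and, near $x^0$, $S$ is the graph $\{(x_1,x_2,1+\phi(x_1,x_2)):(x_1,x_2)\in\Omega\}$ of $1+\phi$, where $\phi$ is a smooth real function on an open neighborhood $\Omega$ of $0\in\mathbb{R}^2$ with $\phi(0,0)=0$, $\nabla\phi(0,0)=0$. Height: let $\phi(x)\sim\sum c_{\alpha_1,\alpha_2}x_1^{\alpha_1}x_2^{\alpha_2}$ be the Taylor series at the origin and $\mathcal{T}(\phi)=\{\alpha\in\mathbb{N}^2: c_\alpha\neq0\}$; the height is considered when $\mathcal{T}(\phi)\neq\emptyset$ (finite type), and the condition $h(x^0,S)<2$ is understood to include this. The Newton polyhedron $\mathcal{N}(\phi)$ is the convex hull of $\bigcup_{\alpha\in\mathcal{T}(\phi)}(\alpha+\mathbb{R}_+^2)$. The Newton distance $d(\phi)$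 is the coordinate $d$ of the point $(d,d)$ at which the bisectrix $t_1=t_2$ meets the boundary of $\mathcal{N}(\phi)$. The height is $h(\phi):=\sup\{d_y\}$, the supremum over all smooth local coordinate systems $y=(y_1,y_2)$ near the origin preserving $0$, where $d_y$ is the Newton distance of $\phi$ expressed in the coordinates $y$. One sets $h(x^0,S):=h(\phi)$; this does not depend on the choice of the linear coordinates above. *)

(* Defs.v *)
From HB Require Import structures.
From mathcomp Require Import all_boot all_order all_algebra.
From mathcomp Require Import all_classical all_reals all_analysis.

Set Implicit Arguments.
Unset Strict Implicit.
Unset Printing Implicit Defensive.

Import Order.TTheory GRing.Theory Num.Theory.
Import numFieldNormedType.Exports.

Local Open Scope classical_set_scope.
Local Open Scope ring_scope.

Notation R2 R := (R * R)%type.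
Notation R3 R := (R * R * R)%type.

(* The same carriers, with the product Borel sigma-algebra for which
   [lebesgue_measure] is declared. *)
Notation mR2 R := (measurableTypeR R * measurableTypeR R)%type.
Notation mR3 R :=
  (measurableTypeR R * measurableTypeR R * measurableTypeR R)%type.

Definition lebesgue2 (R : realType) : {measure set (mR2 R) -> \bar R} :=
  (@lebesgue_measure R \x @lebesgue_measure R)%E.

Definition lebesgue3 (R : realType) : {measure set (mR3 R) -> \bar R} :=
  ((@lebesgue_measure R \x @lebesgue_measure R) \x @lebesgue_measure R)%E.

(** * Smoothness *)

(* Meant for open [D]: then ['D_v f x], for [x] in [D], only depends on the
   restriction of [f] to [D]. *)
Fixpoint Ck_on (R : realType) (V W : normedModType R) (k : nat)
    (D : set V) (f : V -> W) : Prop :=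
  (forall x, D x -> {for x, continuous f}) /\
  if k is k'.+1 then
    forall v : V, (forall x, D x -> derivable f x v) /\ Ck_on k' D ('D_v f)
  else True.

Definition smooth_on (R : realType) (V W : normedModType R)
    (D : set V) (f : V -> W) : Prop :=
  forall k, Ck_on k D f.

(** * Hypersurfaces in R^3 *)

(* Embedded hypersurface, not necessarily closed in R^3. *)
Definition smooth_hypersurface (R : realType) (S : set (R3 R)) : Prop :=
  forall x, S x -> exists (U : set (R3 R)) (F : R3 R -> R),
    [/\ open U, U x, smooth_on U F,
        (forall y, U y -> exists v : R3 R, 'D_v F y != 0) &
        S `&` U = [set y | U y /\ F y = 0]].

(* Velocities at [x] of the smooth curves drawn on [S] through [x]. *)
Definition tangent_space (R : realType) (S : set (R3 R)) (x : R3 R) :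
    set (R3 R) :=
  [set v | exists (e : R) (g : R -> R3 R),
    [/\ 0 < e, smooth_on (ball (0 : R) e) g,
        (forall t, ball (0 : R) e t -> S (g t)),
        g 0 = x & 'D_(1 : R) g 0 = v]].

Definition transversality (R : realType) (S : set (R3 R)) : Prop :=
  forall x, S x -> ~ [set x + v | v in tangent_space S x] 0.

(* [rho] is a function on the ambient space of which only the restriction to
   [S] matters. *)
Definition smooth_compactly_supported (R : realType) (S : set (R3 R))
    (rho : R3 R -> R) : Prop :=
  (forall x, S x -> exists (U : set (R3 R)) (g : R3 R -> R),
     [/\ open U, U x, smooth_on U g & forall y, S y -> U y -> rho y = g y]) /\
  (exists K : set (R3 R),
     [/\ compact K, K `<=` S & forall y, S y -> ~ K y -> rho y = 0]).

(** * Surface measure *)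

Definition dot3 (R : realType) (u v : R3 R) : R :=
  u.1.1 * v.1.1 + u.1.2 * v.1.2 + u.2 * v.2.

(* sqrt (E G - F^2), i.e. the norm of the cross product of the two partial
   derivatives of [psi] *)
Definition area_density (R : realType) (psi : R2 R -> R3 R) (u : R2 R) : R :=
  let d1 := 'D_((1, 0) : R2 R) psi u in
  let d2 := 'D_((0, 1) : R2 R) psi u in
  Num.sqrt (dot3 d1 d1 * dot3 d2 d2 - dot3 d1 d2 ^+ 2).

Definition regular_patch (R : realType) (S : set (R3 R))
    (Omega : set (R2 R)) (psi : R2 R -> R3 R) : Prop :=
  [/\ open Omega, smooth_on Omega psi, psi @` Omega `<=` S,
      {in Omega &, injective psi} &
      forall u, Omega u -> forall v : R2 R, 'D_v psi u = 0 -> v = 0].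

(* This determines the values of [sigma] on the Borel subsets of [S] (which is
   covered by countably many patches); its values off [S] are irrelevant. *)
Definition is_surface_measure (R : realType) (S : set (R3 R))
    (sigma : {measure set (mR3 R) -> \bar R}) : Prop :=
  forall (Omega : set (R2 R)) (psi : R2 R -> R3 R), regular_patch S Omega psi ->
  forall B : set (mR3 R), measurable B -> B `<=` psi @` Omega ->
    sigma B = (\int[lebesgue2 R]_(u in Omega `&` psi @^-1` B)
                 (area_density psi u)%:E)%E.

(** * Maximal operator *)

Definition maximal_operator (R : realType) (S : set (R3 R))
    (sigma : {measure set (mR3 R) -> \bar R}) (rho f : R3 R -> R)
    (x : R3 R) : \bar R :=
  ereal_sup
    [set `| \int[sigma]_(y in S) (f (x - t *: (y : R3 R)) * rho y)%:E |%E
    | t in [set t : R | 0 < t]].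

Definition maximal_operator_bounded (R : realType) (S : set (R3 R))
    (sigma : {measure set (mR3 R) -> \bar R}) (rho : R3 R -> R)
    (p : \bar R) : Prop :=
  exists C : R, forall f : mR3 R -> R, f \in Lfun (lebesgue3 R) p ->
    ('N[lebesgue3 R]_p[maximal_operator S sigma rho f]
       <= C%:E * 'N[lebesgue3 R]_p[EFin \o f])%E.

(** * Newton polyhedra and height *)

Definition taylor_coef (R : realType) (phi : R2 R -> R) (a : nat * nat) : R :=
  iter a.1 (fun f : R2 R -> R => 'D_((1, 0) : R2 R) f)
    (iter a.2 (fun f : R2 R -> R => 'D_((0, 1) : R2 R) f) phi) 0
  / (a.1`! * a.2`!)%:R.

Definition taylor_support (R : realType) (phi : R2 R -> R) : set (nat * nat) :=
  [set a | taylor_coef phi a != 0].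

Definition convex_hull (R : realType) (A : set (R2 R)) : set (R2 R) :=
  smallest (@convex_set R (R2 R)) A.

Definition newton_polyhedron (R : realType) (phi : R2 R -> R) : set (R2 R) :=
  convex_hull (\bigcup_(a in taylor_support phi)
    [set t : R2 R | a.1%:R <= t.1 /\ a.2%:R <= t.2]).

Definition is_newton_distance (R : realType) (phi : R2 R -> R) (d : R) : Prop :=
  (closure (newton_polyhedron phi) `\` interior (newton_polyhedron phi)) (d, d).

(* [Psi] expresses the original coordinates [x] in terms of the new ones [y],
   so that [phi \o Psi] is [phi] in the coordinates [y]. *)
Definition local_coordinates (R : realType) (Psi : R2 R -> R2 R) : Prop :=
  Psi 0 = 0 /\
  exists (U W : set (R2 R)) (Phi : R2 R -> R2 R),
    [/\ open U /\ U 0, open W /\ W 0,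
        smooth_on U Psi /\ smooth_on W Phi,
        (forall y, U y -> W (Psi y) /\ Phi (Psi y) = y) &
        (forall x, W x -> U (Phi x) /\ Psi (Phi x) = x)].

Definition height (R : realType) (phi : R2 R -> R) : \bar R :=
  ereal_sup [set d%:E | d in [set d : R | exists Psi : R2 R -> R2 R,
    local_coordinates Psi /\ is_newton_distance (phi \o Psi) d]].

(* After the linear change of coordinates [L], [x0] becomes (0, 0, 1) and [S]
   is near this point the graph of [1 + phi] over [Omega]. *)
Definition local_normalization (R : realType) (S : set (R3 R)) (x0 : R3 R)
    (L : {linear R3 R -> R3 R}) (Omega : set (R2 R)) (phi : R2 R -> R) : Prop :=
  [/\ bijective L /\ L x0 = (0, 0, 1),
      open Omega /\ Omega 0,
      smooth_on Omega phi,
      phi 0 = 0 /\ (forall v : R2 R, 'D_v phi 0 = 0) &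
      exists V : set (R3 R), open V /\
        L @` S `&` V = [set (u, 1 + phi u) | u in Omega]].

(* [h] is h(x0, S); this includes that [S] is of finite type at [x0]. *)
Definition is_height_at (R : realType) (S : set (R3 R)) (x0 : R3 R)
    (h : \bar R) : Prop :=
  exists (L : {linear R3 R -> R3 R}) (Omega : set (R2 R)) (phi : R2 R -> R),
    [/\ local_normalization S x0 L Omega phi,
        taylor_support phi !=set0 & h = height phi].

(* Main.v *)
(** Let [d] be a Newton distance of [phi o Psi] with [d < 2]. A supporting line
    of the Newton polyhedron at [(d, d)] gives weights [k1 + k2 = 1] with
    [phi o Psi = O(r^d)] on the box [|u_i| <= eta r^k_i], whose area is of order
    [r]. For [1 < p <= d] test the maximal operator on the largest of the
    functions [r^(-d/p)] times the indicator of the slab [|l| <= C r^d], with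
    [r = 2^-k] and [k < N], where [l] is the third normalized coordinate. Its
    [L^p] norm to the power [p] is [O(N)], while the average at dilation
    [t = l x] is at least a constant times [N], uniformly on an open set of
    points [x]; hence [N^p = O(N)], which is absurd. For [p = 1] one tests on
    small balls. Finally the height itself is a Newton distance: the Newton
    distances bounded by a number [< 2] have bounded denominators, so the
    supremum is attained. *)

Require Import Defs.
From HB Require Import structures.
From mathcomp Require Import all_boot all_order all_algebra.
From mathcomp Require Import all_classical all_reals all_analysis.
From mathcomp Require Import measurable_realfun.
From mathcomp Require Import ring lra.

Set Implicit Arguments.
Unset Strict Implicit.
Unset Printing Implicit Defensive.

Import Order.TTheory GRing.Theory Num.Theory.
Import numFieldNormedType.Exports.

Local Open Scope classical_set_scope.
Local Open Scope ring_scope.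

(** * Differential calculus *)

(** One slab alone gives no contradiction at [p = d]. The factor [r^(-d/p)] makes every slab
    contribute the same amount to the p-th power of the norm, and the average coming from scale [r],
    of order [r^(1 - d/p)], is bounded below because [p <= d]. Superposing [N] scales turns constant
    against constant into [N^p] against [N], which also excludes [p = d] but says nothing at
    [p = 1]. There, averages of order [s^2] are played against the volume, of order [s^3], of a ball
    of radius [s].

    The dilation [t = l x] is chosen because [l (P u) = 1 + psi u] gives
    [l (x - t *: P u) = - l x * psi u]. Smallness of [psi] on a box thus puts the translated piece
    of surface into one slab through the origin, whatever [x] is.

    The strict inequality [p > h] is what makes attainment of the supremum necessary: knowing
    [p > d] for each Newton distance [d] would only give [p >= h]. The bound 2 enters here. For
    [1 < d < 2] the supporting line at [(d, d)] is decided by Taylor exponents with a coordinate 0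
    or 1, the others being at height at least 2 for all weights of sum 1. *)

Lemma is_derive_line {R : realType} {V W : normedModType R} (g : V -> W)
    (x v : V) (s : R) : derivable g (x + s *: v) v ->
  is_derive s (1 : R) (fun s : R => g (x + s *: v)) ('D_v g (x + s *: v)).
Proof.
have E : (fun h : R => h^-1 *: (((fun s0 => g (x + s0 *: v)) \o shift s) (h *: 1)
      - g (x + s *: v))) =
   (fun h : R => h^-1 *: ((g \o shift (x + s *: v)) (h *: v) - g (x + s *: v))).
  apply/funext => h /=.
  by rewrite [h *: 1]mulr1 scalerDl addrCA.
move=> dg; apply: DeriveDef; first by rewrite /derivable E.
by rewrite /derive E.
Qed.

Lemma MVT_line {R : realType} {V : normedModType R} (g : V -> R) (x v : V)
    (t : R) : (forall s : R, `|s| <= `|t| -> derivable g (x + s *: v) v) ->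
  exists2 s : R, `|s| <= `|t| & g (x + t *: v) - g x = t * 'D_v g (x + s *: v).
Proof.
move=> dg; pose G (s : R) := g (x + s *: v).
have dG (s : R) : `|s| <= `|t| -> is_derive s (1 : R) G ('D_v g (x + s *: v)).
  by move=> st; apply: is_derive_line; apply: dg.
have cG (s : R) : `|s| <= `|t| -> {for s, continuous G}.
  by move=> /dG [dGs _]; exact/differentiable_continuous/derivable1_diffP.
have [t0|t0] := leP 0 t.
  have [||s] := @MVT_segment R G (fun s => 'D_v g (x + s *: v)) 0 t t0.
  - move=> s; rewrite in_itv/= => /andP[s0 st]; apply: dG.
    by rewrite !ger0_norm// ltW.
  - apply/continuous_in_subspaceT => s; rewrite inE/= in_itv/= => /andP[s0 st].
    by apply: cG; rewrite !ger0_norm.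
  rewrite in_itv/= => /andP[s0 st] e; exists s; first by rewrite !ger0_norm.
  by move: e; rewrite /G scale0r addr0 subr0 mulrC.
have [||s] := @MVT_segment R G (fun s => 'D_v g (x + s *: v)) t 0 (ltW t0).
- move=> s; rewrite in_itv/= => /andP[s0 st]; apply: dG.
  by rewrite !ler0_norm ?lerN2// ltW.
- apply/continuous_in_subspaceT => s; rewrite inE/= in_itv/= => /andP[s0 st].
  by apply: cG; rewrite !ler0_norm ?lerN2// ltW.
rewrite in_itv/= => /andP[s0 st] e; exists s.
  by rewrite !ler0_norm ?lerN2// ltW.
move: e; rewrite /G scale0r addr0 sub0r mulrC => e.
by rewrite -opprB e mulNr opprK.
Qed.

Lemma differentiable_of_littleo {R : realType} {V W : normedModType R}
    (f : V -> W) (x : V) (L : {linear V -> W}) :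
  continuous L ->
  (forall e : R, 0 < e -> \forall h \near (0 : V),
     `|f (h + x) - f x - L h| <= e * `|h|) ->
  differentiable f x.
Proof.
move=> cL H.
have E : f \o shift x = cst (f x) + L +o_ 0 id.
  apply/eqaddoP => _/posnumP[e]; have := H e%:num [gt0 of e%:num].
  apply: filterS => h /=; rewrite /cst /= => {}H.
  by rewrite /(_ - _) /= opprD addrA /=.
have dE := diff_unique cL E.
by apply/diff_locallyP; rewrite dE.
Qed.

Definition linear2 {R : realType} (a b : R) (h : R2 R) : R := h.1 * a + h.2 * b.

Lemma linear2_is_linear {R : realType} (a b : R) : linear (linear2 a b).
Proof. by move=> k u v; rewrite /linear2 /= /GRing.scale /=; ring. Qed.

HB.instance Definition _ {R : realType} (a b : R) :=
  GRing.isLinear.Build R (R2 R) R _ (linear2 a b) (linear2_is_linear a b).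

Lemma continuous_linear2 {R : realType} (a b : R) : continuous (linear2 a b).
Proof.
move=> x; rewrite /linear2; apply: cvgD; apply: cvgMl; [exact: cvg_fst|exact: cvg_snd].
Qed.

Lemma norm_pair_le {R : realType} {V W : normedModType R} (u : V * W) (e : R) :
  (`|u| <= e) = (`|u.1| <= e) && (`|u.2| <= e).
Proof. by rewrite prod_normE/= ge_max. Qed.

Lemma norm_pair_lt {R : realType} {V W : normedModType R} (u : V * W) (e : R) :
  (`|u| < e) = (`|u.1| < e) && (`|u.2| < e).
Proof. by rewrite prod_normE/= gt_max. Qed.

Section C1.
Context {R : realType} (D : set (R2 R)) (f : R2 R -> R) (x : R2 R).
Hypotheses (oD : open D) (Dx : D x) (Cf : Ck_on 1 D f).

Let a := 'D_((1, 0) : R2 R) f x.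
Let b := 'D_((0, 1) : R2 R) f x.

(** The increment is split along a path of two axis-parallel legs, vertical and then horizontal. The
    mean value theorem on each leg and continuity of the partial derivatives bound each error by
    [e / 2] times the norm. Since [Ck_on] only speaks of directional derivatives, this is the source
    of the differentiability that the chain rule needs. *)
Lemma C1_littleo (e : R) : 0 < e -> \forall h \near (0 : R2 R),
  `|f (h + x) - f x - linear2 a b h| <= e * `|h|.
Proof.
move=> e0; have [_ C1] := Cf.
have [d1 [c1 _]] := C1 (1, 0); have [d2 [c2 _]] := C1 (0, 1).
have e2 : 0 < e / 2 by rewrite divr_gt0.
have n1 : \forall y \near x, `|a - 'D_((1, 0) : R2 R) f y| < e / 2.
  by move/cvgrPdist_lt: (c1 _ Dx) => /(_ _ e2).
have n2 : \forall y \near x, `|b - 'D_((0, 1) : R2 R) f y| < e / 2.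
  by move/cvgrPdist_lt: (c2 _ Dx) => /(_ _ e2).
have nD : \forall y \near x, D y by exact: open_nbhs_nbhs.
have /nbhs_ballP[d /= d0 H] : nbhs x (D `&` ([set y | `|a - 'D_((1, 0) : R2 R) f y| < e / 2]
    `&` [set y | `|b - 'D_((0, 1) : R2 R) f y| < e / 2])).
  exact: filterI nD (filterI n1 n2).
apply/nbhs_ballP; exists d => //= h.
rewrite -ball_normE/= sub0r normrN norm_pair_lt => /andP[h1 h2].
have inb (s t : R) : `|s| <= `|h.1| -> `|t| <= `|h.2| ->
    ball x d (x + (s, t)).
  move=> sh th; rewrite -ball_normE/= opprD addrA subrr sub0r normrN.
  by rewrite norm_pair_lt /= (le_lt_trans sh)// (le_lt_trans th).
have [|s sh E1] := @MVT_line R (R2 R) f (x + (0, h.2)) (1, 0) h.1.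
  move=> s sh; apply: d1; rewrite -addrA.
  have -> : (0, h.2) + s *: (1, 0) = (s, h.2) :> R2 R.
    by congr pair => /=; rewrite /GRing.scale /=; ring.
  by have [] := H _ (inb _ _ sh (lexx _)).
have [|t th E2] := @MVT_line R (R2 R) f x (0, 1) h.2.
  move=> t th; apply: d2.
  have -> : t *: (0, 1) = (0, t) :> R2 R.
    by congr pair => /=; rewrite /GRing.scale /=; ring.
  by have [] := H _ (inb 0 _ (eq_ind_r (fun z => z <= _) (normr_ge0 _) (normr0 _)) th).
move: E1 E2.
have -> : x + (0, h.2) + h.1 *: (1, 0) = h + x :> R2 R.
  by case: h {h1 h2 inb s sh t th} => ? ?; case: (x) => ? ?;
     congr pair => /=; rewrite /GRing.scale /=; ring.
have -> : x + (0, h.2) + s *: (1, 0) = x + (s, h.2) :> R2 R.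
  by rewrite -addrA; congr (_ + _); congr pair => /=; rewrite /GRing.scale /=; ring.
have -> : x + h.2 *: (0, 1) = x + (0, h.2) :> R2 R.
  by congr (_ + _); congr pair => /=; rewrite /GRing.scale /=; ring.
have -> : x + t *: (0, 1) = x + (0, t) :> R2 R.
  by congr (_ + _); congr pair => /=; rewrite /GRing.scale /=; ring.
move=> E1 E2.
have [_ [b1 _]] := H _ (inb _ _ sh (lexx _)).
have h0 : `|0 : R| <= `|h.1| by rewrite normr0.
have [_ [_ b2]] := H _ (inb _ _ h0 th).
have -> : f (h + x) - f x - linear2 a b h =
  h.1 * ('D_((1, 0) : R2 R) f (x + (s, h.2)) - a) +
  h.2 * ('D_((0, 1) : R2 R) f (x + (0, t)) - b).
  rewrite !mulrBr -E1 -E2 /linear2; ring.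
rewrite (le_trans (ler_normD _ _))// [e]splitr mulrDl.
have [n1h n2h] : `|h.1| <= `|h| /\ `|h.2| <= `|h|.
  by apply/andP; rewrite -norm_pair_le.
by apply: lerD; rewrite normrM mulrC ler_pM// distrC ltW.
Qed.

Lemma C1_differentiable : differentiable f x.
Proof.
exact: (@differentiable_of_littleo _ _ _ _ _ (linear2 a b) (@continuous_linear2 _ a b) C1_littleo).
Qed.

Lemma C1_derive (v : R2 R) : 'D_v f x = v.1 * a + v.2 * b.
Proof.
rewrite (deriveE _ C1_differentiable).
have -> : v = v.1 *: (1, 0) + v.2 *: (0, 1).
  by case: v => v1 v2; congr pair => /=; rewrite /GRing.scale /=; ring.
rewrite linearD !linearZ /= -!(deriveE _ C1_differentiable) /GRing.scale /=.
rewrite -/a -/b; ring.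
Qed.

End C1.

Lemma derive_lineE {R : realType} {V W : normedModType R} (g : V -> W) (x v : V) :
  'D_v g x = 'D_(1 : R) (fun h : R => g (h *: v + x)) 0.
Proof.
rewrite /derive; apply: (congr1 (fun F : R -> W => lim (F @ 0^'))); apply/funext => h /=.
by rewrite addr0 scale0r add0r [h *: 1]mulr1.
Qed.

(** Only a directional derivative of [g] is assumed, so the chain rule is applied to [f] and the
    curve [h |-> g (h *: v + x)], which is differentiable at 0. *)
Lemma is_derive_comp {R : realType} {V W X : normedModType R} (f : W -> X)
    (g : V -> W) (x v : V) : derivable g x v -> differentiable f (g x) ->
  is_derive x v (f \o g) ('d f (g x) ('D_v g x)).
Proof.
move=> dg df; pose c (h : R) := g (h *: v + x).
have c0 : c 0 = g x by rewrite /c scale0r add0r.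
have dc : differentiable c 0 by exact/derivable1_diffP/(derivable1P _ _ _).1.
have dfc : differentiable (f \o c) 0.
  by apply: differentiable_comp => //; rewrite c0.
apply: DeriveDef.
  exact: (derivable1P (f \o g) x v).2 ((derivable1_diffP (f \o c) 0).2 dfc).
rewrite derive_lineE -[fun h => _]/(f \o c) (deriveE _ dfc) diff_comp ?c0//=.
by rewrite (derive_lineE g) (deriveE _ dc).
Qed.

(** * Stability properties of functions of class C^k *)

Section Ck.
Context {R : realType}.
Implicit Types V W X : normedModType R.

Lemma Ck_on_sub V W k (D E : set V) (f : V -> W) :
  E `<=` D -> Ck_on k D f -> Ck_on k E f.
Proof.
move=> ED; elim: k f => [|k IH] f [cf Cf]; first by split=> // x /ED/cf.
split=> [x /ED/cf//|v].
by have [df Cdf] := Cf v; split => [x /ED/df//|]; apply: IH.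
Qed.

Lemma Ck_onW V W k (D : set V) (f : V -> W) : Ck_on k.+1 D f -> Ck_on k D f.
Proof.
elim: k f => [|k IH] f [cf Cf]; first by split.
split=> // v.
by have [df Cdf] := Cf v; split=> //; apply: IH.
Qed.

Lemma Ck_on_leq V W k j (D : set V) (f : V -> W) :
  (j <= k)%N -> Ck_on k D f -> Ck_on j D f.
Proof.
by move=> /subnK <-; elim: (k - j)%N => [//|n IH]; rewrite addSn => /Ck_onW.
Qed.

Lemma Ck_on_eq V W k (D : set V) (f g : V -> W) : open D ->
  (forall x, D x -> f x = g x) -> Ck_on k D f -> Ck_on k D g.
Proof.
move=> oD; elim: k f g => [|k IH] f g fg [cf Cf].
- split=> // x Dx; rewrite /prop_for /continuous_at -fg//.
  apply: cvg_trans (cf _ Dx); apply: near_eq_cvg.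
  by near=> y; apply: fg; near: y; exact: open_nbhs_nbhs.
- have nfg x : D x -> \forall y \near x, f y = g y.
    by move=> Dx; near=> y; apply: fg; near: y; exact: open_nbhs_nbhs.
  split.
    move=> x Dx; rewrite /prop_for /continuous_at -fg//.
    by apply: cvg_trans (cf _ Dx); apply: near_eq_cvg; exact: nfg.
  move=> v; have [df Cdf] := Cf v; split.
    by move=> x Dx; apply: near_eq_derivable (nfg _ Dx) (df _ Dx).
  apply: IH Cdf => x Dx; apply: near_eq_derive; exact: nfg.
Unshelve. all: by end_near. Qed.

Lemma Ck_on_cst V W k (D : set V) (w : W) : Ck_on k D (cst w).
Proof.
elim: k w => [|k IH] w; first by split => // x _; exact: cvg_cst.
split => [x _|v]; first exact: cvg_cst.
split => [x _|]; first exact: derivable_cst.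
have -> : 'D_v (cst w : V -> W) = cst 0 by apply/funext => x; rewrite derive_cst.
exact: IH.
Qed.

Lemma Ck_onD V W k (D : set V) (f g : V -> W) : open D ->
  Ck_on k D f -> Ck_on k D g -> Ck_on k D (f + g).
Proof.
move=> oD; elim: k f g => [|k IH] f g [cf Cf] [cg Cg].
  by split => // x Dx; apply: cvgD; [exact: cf|exact: cg].
split => [x Dx|v]; first by apply: cvgD; [exact: cf|exact: cg].
 have [df Cdf] := Cf v; have [dg Cdg] := Cg v; split.
  by move=> x Dx; apply: derivableD; [exact: df|exact: dg].
apply: Ck_on_eq (IH _ _ Cdf Cdg) => // x Dx.
by rewrite deriveD; [|exact: df|exact: dg].
Qed.

Lemma Ck_onM V k (D : set V) (f g : V -> R) : open D ->
  Ck_on k D f -> Ck_on k D g -> Ck_on k D (f * g).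
Proof.
move=> oD; elim: k f g => [|k IH] f g Hf Hg.
  by split=> // x Dx; apply: cvgM; [apply: Hf.1|apply: Hg.1].
split=> [x Dx|]; first by apply: cvgM; [apply: Hf.1|apply: Hg.1].
move=> v; have [df Cdf] := Hf.2 v; have [dg Cdg] := Hg.2 v; split.
  by move=> x Dx; apply: derivableM; [exact: df|exact: dg].
apply: (@Ck_on_eq _ _ _ _ (f * 'D_v g + g * 'D_v f)) => //.
  by move=> x Dx; rewrite deriveM; [|exact: df|exact: dg].
by apply: Ck_onD => //; apply: IH => //; apply: Ck_onW.
Qed.

Lemma Ck_on_linear_comp V W X k (D : set V) (L : {linear W -> X}) (f : V -> W) :
  open D -> continuous L -> Ck_on k D f -> Ck_on k D (L \o f).
Proof.
move=> oD cL; elim: k f => [|k IH] f [cf Cf].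
  by split => // x Dx; apply: continuous_comp; [exact: cf|exact: cL].
split; first by move=> x Dx; apply: continuous_comp; [exact: cf|exact: cL].
move=> v; have [df Cdf] := Cf v.
have H x : D x -> is_derive x v (L \o f) (L ('D_v f x)).
  move=> Dx; have := is_derive_comp (df _ Dx) (@linear_differentiable _ _ _ L (f x) cL).
  by rewrite (diff_lin _ cL).
split => [x Dx|]; first by have [] := H x Dx.
apply: Ck_on_eq (IH _ Cdf) => // x Dx.
by have [_ ->] := H x Dx.
Qed.

(** Induction on [k] for all [f] at once: a derivative of [f \o g] is the sum of the two components
    of ['D_v g], each multiplied by a partial derivative of [f] composed with [g]. The induction
    hypothesis covers these compositions. *)
Lemma Ck_on_comp2 V k (D : set V) (E : set (R2 R)) (g : V -> R2 R)
    (f : R2 R -> R) : open D -> open E -> (forall x, D x -> E (g x)) ->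
  Ck_on k E f -> Ck_on k D g -> Ck_on k D (f \o g).
Proof.
move=> oD oE DE; elim: k f => [|k IH] f Hf Hg.
  by split => // x Dx; apply: continuous_comp; [exact: Hg.1|apply/Hf.1/DE].
split=> [x Dx|v].
  by apply: continuous_comp; [exact: Hg.1|apply/Hf.1/DE].
have C1 : Ck_on 1 E f by apply: Ck_on_leq Hf.
have [dg Cdg] := Hg.2 v.
have H x : D x -> is_derive x v (f \o g)
   ((fst \o 'D_v g) x * 'D_((1, 0) : R2 R) f (g x) +
    (snd \o 'D_v g) x * 'D_((0, 1) : R2 R) f (g x)).
  move=> Dx; rewrite -(C1_derive oE (DE _ Dx) C1 ('D_v g x)).
  have df := C1_differentiable oE (DE _ Dx) C1.
  by rewrite (deriveE _ df); apply: is_derive_comp => //; exact: dg.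
split => [x Dx|]; first by have [] := H x Dx.
apply: (@Ck_on_eq _ _ _ _
   ((fst \o 'D_v g) * ('D_((1, 0) : R2 R) f \o g) +
    (snd \o 'D_v g) * ('D_((0, 1) : R2 R) f \o g))) => //.
  by move=> x Dx; have [_ ->] := H x Dx.
have [_ C10] := Hf.2 (1, 0); have [_ C01] := Hf.2 (0, 1).
apply: Ck_onD => //; apply: Ck_onM => //.
- by apply: Ck_on_linear_comp => // x; exact: cvg_fst.
- by apply: IH => //; exact: Ck_onW.
- by apply: Ck_on_linear_comp => // x; exact: cvg_snd.
- by apply: IH => //; exact: Ck_onW.
Qed.

End Ck.

(** * Newton distances *)

Section newton.
Context {R : realType} (phi : R2 R -> R).
Let T := taylor_support phi.
Let N := newton_polyhedron phi.

Lemma convex_setE (A : set (R2 R)) : convex_set A <->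
  (forall (x y : R2 R) (p : R), A x -> A y -> 0 <= p <= 1 ->
    A (p *: x + (1 - p) *: y)).
Proof.
split => [cA x y p Ax Ay p01|H].
  have q : {q : {i01 R} | q%:num = p}.
    exists (Itv01 (proj1 (andP p01)) (proj2 (andP p01))) => //.
  case: q => q <-.
  by have := cA x y q; rewrite !inE => /(_ Ax Ay).
move=> x y q; rewrite !inE => Ax Ay; apply: H => //.
by apply/andP; split => //.
Qed.

Lemma newton_polyhedron_convex : convex_set N.
Proof.
move=> x y p /set_mem Nx /set_mem Ny; apply/mem_set => B [cB gB].
apply/set_mem/cB; apply/mem_set; [exact: Nx|exact: Ny].
Qed.

(** The points all of whose upward translates lie in [N] form a convex set containing the generating
    quadrants, hence containing the hull. *)
Lemma newton_polyhedron_upward (x y : R2 R) :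
  N x -> x.1 <= y.1 -> x.2 <= y.2 -> N y.
Proof.
move=> Nx xy1 xy2.
pose A := [set x : R2 R | forall y, x.1 <= y.1 -> x.2 <= y.2 -> N y].
suff : N `<=` A by move=> /(_ _ Nx); exact.
apply: smallest_sub; last first.
  move=> u [a Ta [/= a1 a2]] v uv1 uv2 B [_ ]; apply.
  by exists a => //; split; [exact: le_trans uv1|exact: le_trans uv2].
apply/convex_setE => u v p Au Av p01 w /= w1 w2.
(* The excess of [w] over the convex combination has nonnegative coordinates and can be added to
   both endpoints. *)
pose c : R2 R := w - (p *: u + (1 - p) *: v).
have -> : w = p *: (u + c) + (1 - p) *: (v + c).
  rewrite /c {w1 w2 c}; case: w u v Au Av => w1 w2 [u1 u2] [v1 v2] _ _.
  by congr pair; rewrite /= /GRing.scale /=; ring.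
have c1 : 0 <= c.1 by rewrite /c /= subr_ge0.
have c2 : 0 <= c.2 by rewrite /c /= subr_ge0.
apply: (convex_setE _).1 newton_polyhedron_convex _ _ _ _ _ p01.
  by apply: Au => /=; rewrite lerDl.
by apply: Av => /=; rewrite lerDl.
Qed.

Lemma newton_polyhedron_vertex (a : nat * nat) : T a -> N (a.1%:R, a.2%:R).
Proof. by move=> Ta B [_]; apply; exists a. Qed.

Lemma newton_polyhedron_halfplane (k1 k2 e : R) : 0 <= k1 -> 0 <= k2 ->
  (forall a, T a -> e <= k1 * a.1%:R + k2 * a.2%:R) ->
  closure N `<=` [set x | e <= k1 * x.1 + k2 * x.2].
Proof.
move=> k10 k20 H.
have cl : closed [set x : R2 R | e <= linear2 k1 k2 x].
  apply: (@closed_comp _ _ (linear2 k1 k2) [set y | e <= y]); last exact: closed_ge.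
  by move=> x _; exact: continuous_linear2.
have -> : [set x : R2 R | e <= k1 * x.1 + k2 * x.2] =
    [set x : R2 R | e <= linear2 k1 k2 x].
  by apply/seteqP; split => x; rewrite /linear2 /= mulrC [k2 * _]mulrC.
rewrite [X in _ `<=` X](closure_id _).1//; apply: closure_subset.
apply: smallest_sub.
  apply/convex_setE => x y p /= ex ey /andP[p0 p1].
  rewrite linearD !linearZ /= /GRing.scale /=.
  have -> : e = p * e + (1 - p) * e by ring.
  by apply: lerD; rewrite ler_wpM2l// subr_ge0.
move=> u [a Ta [a1 a2]] /=; apply: le_trans (H _ Ta) _.
by rewrite /linear2 ![_ * k1]mulrC ![_ * k2]mulrC; apply: lerD; rewrite ler_wpM2l.
Qed.

Variable d : R.
Hypothesis dN : is_newton_distance phi d.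

(** A point of [N] with both coordinates below [d] would have a whole ball around [(d, d)] above it,
    making [(d, d)] interior. *)
Lemma newton_distance_minimal (x : R2 R) : N x -> d <= x.1 \/ d <= x.2.
Proof.
move=> Nx; have [|x1] := leP d x.1; first by left.
right; rewrite leNgt; apply/negP => x2.
case: dN => _; apply; apply/nbhs_ballP.
exists (Num.min (d - x.1) (d - x.2)); first by rewrite /= lt_min !subr_gt0 x1.
move=> y; rewrite -ball_normE /= norm_pair_lt /= !lt_min => /andP[/andP[y1 _] /andP[_ y2]].
apply: newton_polyhedron_upward Nx _ _.
  by move: y1; rewrite ltr_norml => /andP[_]; lra.
by move: y2; rewrite ltr_norml => /andP[_]; lra.
Qed.

Lemma newton_distance_halfplane (k1 k2 e : R) : 0 <= k1 -> 0 <= k2 ->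
  k1 + k2 = 1 ->
  (forall a, T a -> e <= k1 * a.1%:R + k2 * a.2%:R) -> e <= d.
Proof.
move=> k10 k20 k1k2 H.
have := @newton_polyhedron_halfplane _ _ e k10 k20 H (d, d) dN.1.
by rewrite /= -mulrDl k1k2 mul1r.
Qed.

(** The segment from [a] to [b] crosses the bisectrix at a point of [N], whose common coordinate is
    therefore at least [d]. Clearing denominators, this is the stated inequality between the slopes
    of the lines joining [(d, d)] to [a] and to [b]. *)
Lemma newton_distance_segment (a b : nat * nat) : T a -> T b ->
  a.1%:R < a.2%:R :> R -> b.2%:R < b.1%:R :> R ->
  (d - a.1%:R) / (a.2%:R - a.1%:R) + (d - b.2%:R) / (b.1%:R - b.2%:R) <= 1.
Proof.
move=> Ta Tb a12 b21; set p : R := a.2%:R - _; set q : R := b.1%:R - _.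
have p0 : 0 < p by rewrite subr_gt0.
have q0 : 0 < q by rewrite subr_gt0.
have pq : 0 < p + q by rewrite addr_gt0.
have l01 : 0 <= q / (p + q) <= 1.
  apply/andP; split; first by rewrite divr_ge0// ltW.
  by rewrite ler_pdivrMr// mul1r; lra.
have := (convex_setE _).1 newton_polyhedron_convex _ _ _
  (newton_polyhedron_vertex Ta) (newton_polyhedron_vertex Tb) l01.
set x := (X in N X).
have E : x.1 = x.2.
  by rewrite /x /= /GRing.scale /= /p /q; field; rewrite -/p -/q gt_eqF.
have Ex : x.1 = (q * a.1%:R + p * b.1%:R) / (p + q).
  by rewrite /x /= /GRing.scale /=; field; rewrite gt_eqF.
move=> /newton_distance_minimal; rewrite -E => -[]; rewrite Ex ler_pdivlMr// => H.
all: rewrite -(ler_pM2r (mulr_gt0 p0 q0)).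
all: have -> : ((d - a.1%:R) / p + (d - b.2%:R) / q) * (p * q) =
   (d - a.1%:R) * q + (d - b.2%:R) * p by field; rewrite !gt_eqF.
all: move: H; rewrite /p /q; nra.
Qed.

End newton.

(** * The edge of the Newton polyhedron through the bisectrix *)

Lemma column_max {R : realType} (P : set nat) (f : nat -> R) :
  (forall m n, (m <= n)%N -> P m -> P n -> f n <= f m) ->
  P = set0 \/ exists2 m, P m & forall n, P n -> f n <= f m.
Proof.
move=> af; have [->|/set0P[n Pn]] := eqVneq P set0; first by left.
right; have ex : exists n, (fun n => `[< P n >]) n by exists n; apply/asboolP.
case: (ex_minnP ex) => m /asboolP Pm mmin; exists m => // j Pj.
by apply: af => //; apply: mmin; apply/asboolP.
Qed.

(** The set may be infinite, but on each of the two columns the function is largest at the lowest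
    point, so two candidates remain. This will pick the extremal Taylor exponents on either side of
    the bisectrix. *)
Lemma two_columns_max {R : realType} (A : set (nat * nat)) (f : nat * nat -> R) :
  A !=set0 -> (forall a, A a -> (a.1 <= 1)%N) ->
  (forall c m n, (m <= n)%N -> A (c, m) -> A (c, n) -> f (c, n) <= f (c, m)) ->
  exists2 a, A a & forall b, A b -> f b <= f a.
Proof.
move=> [a0 Aa0] A1 af.
have A01 a : A a -> A (0%N, a.2) /\ a = (0%N, a.2) \/ A (1%N, a.2) /\ a = (1%N, a.2).
  by case: a => -[|[|?]] n An; [left|right|have := A1 _ An].
have [E0|[m0 P0 M0]] := column_max (af 0%N); have [E1|[m1 P1 M1]] := column_max (af 1%N).
- by case: (A01 _ Aa0) => [[]|[]] H _; [have : set0 a0.2 by rewrite -E0|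
    have : set0 a0.2 by rewrite -E1].
- exists (1%N, m1) => // b /A01 [[H _]|[H ->]]; last exact: M1.
  by have : set0 b.2 by rewrite -E0.
- exists (0%N, m0) => // b /A01 [[H ->]|[H _]]; first exact: M0.
  by have : set0 b.2 by rewrite -E1.
- have [le|/ltW le] := leP (f (0%N, m0)) (f (1%N, m1)).
    exists (1%N, m1) => // b /A01 [[H ->]|[H ->]]; last exact: M1.
    exact: le_trans (M0 _ H) _.
  exists (0%N, m0) => // b /A01 [[H ->]|[H ->]]; first exact: M0.
  exact: le_trans (M1 _ H) _.
Qed.


Section weights.
Context {R : realType} (phi : R2 R -> R) (d : R).
Let T := taylor_support phi.
Hypothesis T2 : forall a, T a -> (2 <= a.1 + a.2)%N.
Hypothesis dN : is_newton_distance phi d.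
Hypothesis d2 : d < 2.

Lemma newton_distance_ge1 : 1 <= d.
Proof.
apply: (newton_distance_halfplane dN (k1 := 2^-1) (k2 := 2^-1)); rewrite ?invr_ge0//; first lra.
move=> a Ta; have : (2%:R : R) <= (a.1 + a.2)%:R by rewrite ler_nat; exact: T2.
rewrite natrD; lra.
Qed.

(* The line through (d, d) and [a], with [a.1 < d <= a.2], is
   [(1 - s) t_1 + s t_2 = d] for [s = slope a]. *)
Let slope (a : nat * nat) : R := (d - a.1%:R) / (a.2%:R - a.1%:R).

Let swap (a : nat * nat) := (a.2, a.1).

Let swapK : involutive swap. Proof. by case. Qed.

(** An exponent [c] with [c.1 <= 1] lies on the good side of the line [(1 - s) t_1 + s t_2 = d] when
    [slope c <= s], one with [c.2 <= 1] when [slope (swap c) <= 1 - s], and one with both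
    coordinates at least 2 always does, as [d < 2]. The maximal slopes therefore leave an interval
    of admissible [s]. It is nonempty by the segment inequality, and it is a single point because
    otherwise its midpoint would give a line strictly beyond [(d, d)]. *)
Lemma newton_distance_edge : 1 < d ->
  exists a b, [/\ T a /\ T b, (a.1 <= 1)%N /\ (2 <= a.2)%N,
    (b.2 <= 1)%N /\ (2 <= b.1)%N, slope a + slope (swap b) = 1 &
    forall c, T c -> d <= (1 - slope a) * c.1%:R + slope a * c.2%:R].
Proof.
move=> d1.
have low (a : nat * nat) : T a -> (a.1 <= 1)%N -> (2 <= a.2)%N.
  move=> Ta a1; case: (newton_distance_minimal dN (newton_polyhedron_vertex Ta)) => /= H.
    suff : (1 < a.1)%N by rewrite ltnNge a1.
    by rewrite -(ltr_nat R); exact: lt_le_trans H.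
  by rewrite -(ltr_nat R); exact: lt_le_trans H.
have low' (b : nat * nat) : T b -> (b.2 <= 1)%N -> (2 <= b.1)%N.
  move=> Tb b2; case: (newton_distance_minimal dN (newton_polyhedron_vertex Tb)) => /= H.
    by rewrite -(ltr_nat R); exact: lt_le_trans H.
  suff : (1 < b.2)%N by rewrite ltnNge b2.
  by rewrite -(ltr_nat R); exact: lt_le_trans H.
have anti c m n : (c <= 1)%N -> (2 <= m)%N -> (m <= n)%N -> slope (c, n) <= slope (c, m).
  move=> c1 m2 mn; rewrite /slope/=.
  have c1R : c%:R <= 1 :> R by rewrite lern1.
  have m2R : 2 <= m%:R :> R by rewrite ler_nat.
  have mnR : m%:R <= n%:R :> R by rewrite ler_nat.
  rewrite ler_wpM2l ?subr_ge0 ?(le_trans c1R (ltW d1))// lef_pV2 ?posrE; lra.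
have [a [Ta a1] amax] : exists2 a, (T a /\ (a.1 <= 1)%N) &
    forall b, (T b /\ (b.1 <= 1)%N) -> slope b <= slope a.
  apply: (@two_columns_max _ [set a | T a /\ (a.1 <= 1)%N]).
  (* Without exponents in the first two columns, the half plane [t_1 >= 2] contains [N], which
     forces [d >= 2]. *)
  - apply: contrapT => H; suff : 2 <= d by rewrite leNgt d2.
    apply: (newton_distance_halfplane dN (k1 := 1) (k2 := 0)); rewrite ?addr0// => a Ta.
    rewrite mul1r mul0r addr0 ler_nat leqNgt; apply/negP => a1.
    by apply: H; exists a.
  - by move=> ? [].
  - move=> c m n mn [Tm c1] [Tn _]; apply: anti => //; exact: (low _ Tm).
have [b [Tb b1] bmax] : exists2 b, (T (swap b) /\ (b.1 <= 1)%N) &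
    forall c, (T (swap c) /\ (c.1 <= 1)%N) -> slope c <= slope b.
  apply: (@two_columns_max _ [set a | T (swap a) /\ (a.1 <= 1)%N]).
  - apply: contrapT => H; suff : 2 <= d by rewrite leNgt d2.
    apply: (newton_distance_halfplane dN (k1 := 0) (k2 := 1)); rewrite ?add0r// => c Tc.
    rewrite mul1r mul0r add0r ler_nat leqNgt; apply/negP => c2.
    by apply: H; exists (swap c) => //; rewrite /= swapK.
  - by move=> ? [].
  - move=> c m n mn [Tm c1] [Tn _]; apply: anti => //; exact: (low' _ Tm).
have d2' := d2; have a2 := low _ Ta a1.
have b2 := low' _ Tb b1.
(* Here [g] measures the slack. For [c] in the two columns the left-over
   [(s - slope c) * (c.2 - c.1)] is at least [g], since the second factor is at least 1; rows are
   symmetric, and the remaining exponents have weighted height at least [2 >= d + g]. *)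
have key c s : T c -> slope a <= s -> slope b <= 1 - s -> forall g,
    g <= s - slope a -> g <= 1 - s - slope b -> g <= 2 - d -> 0 <= g ->
    0 <= s <= 1 -> d + g <= (1 - s) * c.1%:R + s * c.2%:R.
  move=> Tc sa sb g ga gb gd g0 /andP[s0 s1].
  have [c1|c1] := leqP c.1 1.
    have c2 := low _ Tc c1.
    have m := amax _ (conj Tc c1).
    have c1R : c.1%:R <= 1 :> R by rewrite lern1.
    have c2R : 2 <= c.2%:R :> R by rewrite ler_nat.
    have e : d = (1 - slope c) * c.1%:R + slope c * c.2%:R.
      by rewrite /slope; field; lra.
    rewrite [in X in X <= _]e; nra.
  have [c2|c2] := leqP c.2 1.
    have m : slope (swap c) <= slope b.
      by apply: bmax; rewrite swapK.
    have c1R : c.2%:R <= 1 :> R by rewrite lern1.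
    have c2R : 2 <= c.1%:R :> R by rewrite ler_nat.
    have e : d = slope (swap c) * c.1%:R + (1 - slope (swap c)) * c.2%:R.
      by rewrite /slope /swap /=; field; lra.
    rewrite [in X in X <= _]e; nra.
  have c1R : 2 <= c.1%:R :> R by rewrite ler_nat.
  have c2R : 2 <= c.2%:R :> R by rewrite ler_nat.
  nra.
have a1R : a.1%:R <= 1 :> R by rewrite lern1.
have a2R : 2 <= a.2%:R :> R by rewrite ler_nat.
have b1R : b.1%:R <= 1 :> R by rewrite lern1.
have b2R : 2 <= b.2%:R :> R by rewrite ler_nat.
have sa0 : 0 <= slope a by rewrite divr_ge0; lra.
have sb0 : 0 <= slope b by rewrite divr_ge0; lra.
have : slope a + slope b <= 1.
  by apply: (newton_distance_segment dN Ta Tb) => /=; lra.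
rewrite le_eqVlt => /orP[/eqP E|lt1].
  exists a, (swap b); rewrite swapK; split => //.
  move=> c Tc; rewrite -[X in X <= _]addr0; apply: key => //; (try by apply/andP; split; lra); lra.
exfalso.
(* If the slopes add up to less than 1, [s] below is the midpoint of the admissible interval and [e]
   is at most half its length. All exponents then lie beyond level [d + e], although [(d, d)] is in
   the closure of [N]. *)
pose e := Num.min ((1 - slope a - slope b) / 2) (2 - d).
have e0 : 0 < e by rewrite lt_min; apply/andP; split; lra.
have e1 : e <= (1 - slope a - slope b) / 2 by rewrite ge_min lexx.
have e2 : e <= 2 - d by rewrite ge_min lexx orbT.
suff : d + e <= d by rewrite gerDl leNgt e0.
pose s := (1 + slope a - slope b) / 2.
apply: (newton_distance_halfplane dN (k1 := 1 - s) (k2 := s)); rewrite /s; try lra.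
by move=> c Tc; apply: key => //; (try by apply/andP; split; lra); lra.
Qed.

(** The weights are the coefficients of the edge line; both are positive because the two slopes are
    positive and add up to 1. For [d = 1] equal weights suffice, every exponent having degree at
    least 2. *)
Lemma newton_distance_weights :
  (exists k1 k2 : R, [/\ 0 < k1, 0 < k2, k1 + k2 = 1 &
     forall a, T a -> d <= k1 * a.1%:R + k2 * a.2%:R]) /\
  exists m n : nat, [/\ (0 < n)%N, n%:R <= 4 / (1 - d / 2) & n%:R * d = m%:R].
Proof.
have := newton_distance_ge1; rewrite le_eqVlt => /orP[/eqP <-|d1].
  split; last by exists 1%N, 1%N; split; rewrite ?mulr1// ler_pdivlMr; lra.
  exists 2^-1, 2^-1; split; rewrite ?invr_gt0//; first lra.
  move=> a Ta; have : (2%:R : R) <= (a.1 + a.2)%:R by rewrite ler_nat; exact: T2.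
  rewrite natrD; lra.
have [a [b [[Ta Tb] [a1 a2] [b2 b1] E H]]] := newton_distance_edge d1.
have a1R : a.1%:R <= 1 :> R by rewrite lern1.
have a2R : 2 <= a.2%:R :> R by rewrite ler_nat.
have b2R : b.2%:R <= 1 :> R by rewrite lern1.
have b1R : 2 <= b.1%:R :> R by rewrite ler_nat.
have sa0 : 0 < slope a by rewrite divr_gt0// subr_gt0; lra.
have sb0 : 0 < slope (swap b) by rewrite /slope /swap /= divr_gt0// subr_gt0; lra.
have ea : d = (1 - slope a) * a.1%:R + slope a * a.2%:R.
  by rewrite /slope; field; lra.
have eb : d = slope (swap b) * b.1%:R + (1 - slope (swap b)) * b.2%:R.
  by rewrite /slope /swap /=; field; lra.
split.
  by exists (1 - slope a), (slope a); split => //; lra.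
have a0R : 0 <= a.1%:R :> R by [].
have b0R : 0 <= b.2%:R :> R by [].
(* The relation between the slopes, cleared of denominators, reads [d * ((a.2 - a.1) + (b.1 - b.2))
   = a.2 * b.1 - a.1 * b.2]. *)
exists (a.2 * b.1 - a.1 * b.2)%N, ((a.2 - a.1) + (b.1 - b.2))%N; split.
- by rewrite addn_gt0 subn_gt0 (leq_ltn_trans a1).
- have d20 : 0 < 1 - d / 2 by have := d2; lra.
  (* Each slope is at most [d / 2], since its lower coordinate is at most 1 and the other at least
     2; as they add up to 1, each is also at least [1 - d / 2]. Then [slope a * a.2 <= d < 2] bounds
     [a.2], and likewise [b.1]. *)
  have sa : 1 - d / 2 <= slope a by nra.
  have sb : 1 - d / 2 <= slope (swap b) by nra.
  have a2b : a.2%:R <= 2 / (1 - d / 2) by rewrite ler_pdivlMr//; nra.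
  have b1b : b.1%:R <= 2 / (1 - d / 2) by rewrite ler_pdivlMr//; nra.
  rewrite (_ : 4 / _ = 2 / (1 - d / 2) + 2 / (1 - d / 2)); last by ring.
  by rewrite natrD; apply: lerD; [apply: le_trans a2b|apply: le_trans b1b];
    rewrite ler_nat leq_subr.
- have a12 : (a.1 <= a.2)%N := leq_trans a1 (ltnW a2).
  have b21 : (b.2 <= b.1)%N := leq_trans b2 (ltnW b1).
  rewrite natrD !natrB ?leq_mul// !natrM.
  move: E; rewrite /slope /swap /=.
  set p : R := a.2%:R - _; set q : R := b.1%:R - _.
  have p0 : p != 0 by rewrite /p; lra.
  have q0 : q != 0 by rewrite /q; lra.
  move=> E; have E2 : (d - a.1%:R) * q + (d - b.2%:R) * p = p * q.
    transitivity (((d - a.1%:R) / p + (d - b.2%:R) / q) * (p * q)).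
      by field; rewrite p0 q0.
    by rewrite E mul1r.
  by move: E2; rewrite /p /q; lra.
Qed.

End weights.

(* [N] times a Newton distance below [h] is an integer for a fixed [N], so
   only finitely many values can occur and the supremum is attained. *)
Lemma height_attained {R : realType} (phi : R2 R -> R) (h : R) :
  (forall Psi, local_coordinates Psi ->
    forall a, taylor_support (phi \o Psi) a -> (2 <= a.1 + a.2)%N) ->
  height phi = h%:E -> h < 2 ->
  exists2 Psi, local_coordinates Psi & is_newton_distance (phi \o Psi) h.
Proof.
move=> T2 hE h2.
pose E := [set d : R | exists Psi : R2 R -> R2 R,
    local_coordinates Psi /\ is_newton_distance (phi \o Psi) d].
have Eh d : E d -> d <= h.
  by move=> Ed; rewrite -lee_fin -hE; apply: ereal_sup_ubound; exists d.
(* The bound on denominators increases with [d], so its value at [h] serves for all Newton distances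
   at once and [Q!] is a common multiple of the denominators. *)
pose Q := Num.truncn (4 / (1 - h / 2)).
have h20 : 0 < 1 - h / 2 by lra.
have EQ d : E d -> exists m : nat, (Q`!)%:R * d = m%:R.
  move=> Ed; have dh := Eh _ Ed; case: Ed => Psi [LP dN].
  have [_ [m [n [n0 nQ nd]]]] := newton_distance_weights (T2 _ LP) dN (le_lt_trans dh h2).
  have : (n <= Q)%N.
    rewrite /Q truncn_ge_nat; last by rewrite divr_ge0// ltW.
    by apply: le_trans nQ _; rewrite ler_wpM2l// lef_pV2 ?posrE; lra.
  move=> nQ'; have /dvdnP[k ->] : (n %| Q`!)%N by apply: dvdn_fact; rewrite n0.
  by exists (k * m)%N; rewrite !natrM -mulrA nd.
have E0 : E !=set0.
  apply: contrapT => H; have : height phi = -oo%E; last by rewrite hE.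
  rewrite /height (_ : [set _ | _ in _] = set0) ?ereal_sup0//.
  by apply/seteqP; split => // t [d Ed _]; apply: H; exists d.
have Q0 : 0 < (Q`!)%:R :> R by rewrite ltr0n fact_gt0.
pose P m := `[< exists2 d, E d & (Q`!)%:R * d = m%:R >].
have exP : exists m, P m.
  by have [d Ed] := E0; have [m Em] := EQ _ Ed; exists m; apply/asboolP; exists d.
have ubP m : P m -> (m <= Num.truncn ((Q`!)%:R * h))%N.
  move=> /asboolP[d Ed Em]; have dh := Eh _ Ed.
  have dm : m%:R <= (Q`!)%:R * h by rewrite -Em ler_wpM2l// ltW.
  by rewrite truncn_ge_nat// (le_trans _ dm).
case: (ex_maxnP exP ubP) => M /asboolP[d Ed EM] Mmax.
suff -> : h = d by case: Ed => Psi []; exists Psi.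
apply/eqP; rewrite eq_le Eh// andbT -lee_fin -hE.
apply: ge_ereal_sup => _ [d' Ed' <-]; rewrite lee_fin.
have [m Em] := EQ _ Ed'.
rewrite -(ler_pM2l Q0) EM Em ler_nat; apply: Mmax.
by apply/asboolP; exists d'.
Qed.

Lemma powR_mulB {R : realType} (r x y : R) : 0 < r ->
  r `^ x * r `^ (y - x) = r `^ y.
Proof. by move=> r0; rewrite -powRD ?subrKC// (gt_eqF r0) implybT. Qed.

Lemma box_bounded {R : realType} {W : normedModType R} (D : set (R2 R)) (eta : R)
    (f : R2 R -> W) : 0 <= eta -> (forall u, `|u| <= eta -> D u) -> smooth_on D f ->
  exists2 M, 0 <= M & forall u : R2 R, `|u| <= eta -> `|f u| <= M.
Proof.
move=> eta0 etaD sf; pose A := [set u : R2 R | `|u| <= eta].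
have EA : A = `[- eta, eta] `*` `[- eta, eta].
  by apply/seteqP; split => u; rewrite /A /= norm_pair_le !in_itv /= !ler_norml => /andP.
have cA : compact A by rewrite EA; apply: compact_setX; exact: segment_compact.
have [||c Ac H] := @compact_EVT_max (R2 R) R (fun u => `|f u|) A _ cA.
- by exists 0; rewrite /A /= normr0 eta0.
- apply: continuous_in_subspaceT => u /set_mem Au.
  by apply: (@cvg_norm _ _ _ (nbhs u)); apply: (sf 0%N).1; exact: etaD.
- by exists `|f c| => // u Au; apply: H; exact/mem_set.
Qed.

(** * Decay along weighted boxes *)

(* The decay exponent is propagated from derivatives to the function by the
   mean value theorem, first along the axis [u.2 = 0] and then in [u.2]; this
   only meets the mixed derivatives in the order used by [taylor_coef], so that
   no symmetry of second derivatives is needed. *)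
Section decay.
Context {R : realType} (D : set (R2 R)) (g : R2 R -> R).
Hypotheses (oD : open D) (sg : smooth_on D g).
Variables (eta k1 k2 d : R).
Hypotheses (eta0 : 0 < eta) (k10 : 0 < k1) (k20 : 0 < k2).
Hypothesis etaD : forall u : R2 R, `|u| <= eta -> D u.
Hypothesis dT : forall a, taylor_support g a -> d <= k1 * a.1%:R + k2 * a.2%:R.

Let F a b := iter a (fun f : R2 R -> R => 'D_((1, 0) : R2 R) f)
    (iter b (fun f : R2 R -> R => 'D_((0, 1) : R2 R) f) g).

Lemma smooth_on_derive (f : R2 R -> R) v : smooth_on D f -> smooth_on D ('D_v f).
Proof. by move=> sf k; have [_ /(_ v)[]] := sf k.+1. Qed.

Let smoothF a b : smooth_on D (F a b).
Proof.
rewrite /F; elim: a => [|a IH] /=; last exact: smooth_on_derive.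
by elim: b => [//|b IH] /=; exact: smooth_on_derive.
Qed.

Let F0 a b : 0 < d - k1 * a%:R - k2 * b%:R -> F a b 0 = 0.
Proof.
move=> pos; apply/eqP; apply: contraT => nz.
have /dT /= : taylor_support g (a, b).
  by rewrite /taylor_support /= mulf_neq0 // invr_neq0 // pnatr_eq0 muln_eq0 -!lt0n !fact_gt0.
by move=> H; exfalso; move: pos; rewrite -addrA -opprD subr_gt0 ltNge H.
Qed.

(** The weighted decay exponent left after [a] and [b] differentiations. When it is positive,
    [(a, b)] lies below the supporting line and the derivative vanishes at the origin. *)
Let e a b := d - k1 * a%:R - k2 * b%:R.

Let base a b : e a b <= 0 -> exists2 C, 0 <= C & forall r, 0 < r <= 1 ->
  forall u, `|u| <= eta -> `|F a b u| <= C * r `^ e a b.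
Proof.
move=> e0; have [M M0 HM] := box_bounded (ltW eta0) etaD (@smoothF a b).
exists M => // r r01 u ub; apply: le_trans (HM _ ub) _.
by rewrite ler_peMr// -(powRr0 r); exact: ger_powR.
Qed.

Lemma powR_le1_scale (k r : R) : 0 < k -> 0 < r <= 1 -> eta * r `^ k <= eta.
Proof.
move=> k0 r01.
by rewrite ler_piMr ?(ltW eta0)// -(powRr0 r); apply: ger_powR; rewrite ?(ltW k0).
Qed.

(** [n] bounds the number of further derivatives in the first variable after which the exponent is
    nonpositive and mere boundedness suffices. Going back one derivative, the mean value theorem
    from the origin gains the length [eta * r^k1], which restores the exponent lost. *)
Let axis n a b : e a b <= n%:R * k1 -> exists2 C, 0 <= C & forall r, 0 < r <= 1 ->
  forall t, `|t| <= eta * r `^ k1 -> `|F a b (t, 0)| <= C * r `^ e a b.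
Proof.
elim: n a b => [|n IH] a b.
  rewrite mul0r => /base[C C0 H]; exists C => // r r01 t tr; apply: H => //.
  rewrite norm_pair_le /= normr0 (ltW eta0) andbT (le_trans tr)//.
  exact: powR_le1_scale.
have [e0 _|e0 en] := leP (e a b) 0.
  have [C C0 H] := base e0; exists C => // r r01 t tr; apply: H => //.
  rewrite norm_pair_le /= normr0 (ltW eta0) andbT (le_trans tr)//.
  exact: powR_le1_scale.
have eS : e a.+1 b = e a b - k1 by rewrite /e -natr1; ring.
have [|C C0 H] := IH a.+1 b; first by move: en; rewrite eS -natr1; lra.
exists (eta * C); first by rewrite mulr_ge0 ?(ltW eta0).
move=> r r01 t tr; have [r0 r1] := andP r01.
have vE (s : R) : 0 + s *: (1, 0) = (s, 0) :> R2 R.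
  by congr pair; rewrite /= /GRing.scale /=; ring.
have [|s st] := @MVT_line R (R2 R) (F a b) 0 (1, 0) t.
  move=> s st; have [_ /(_ (1, 0))[+ _]] := smoothF a b 1%N; apply.
  apply: etaD; rewrite vE norm_pair_le /= normr0 (ltW eta0) andbT.
  by rewrite (le_trans st)// (le_trans tr)//; exact: powR_le1_scale.
rewrite !vE F0// subr0 => ->; rewrite normrM.
have := H r r01 s (le_trans st tr).
rewrite -[X in X -> _]/(is_true (`|'D_(1, 0) (F a b) (s, 0)| <= _)) => Hs.
apply: (@le_trans _ _ ((eta * r `^ k1) * (C * r `^ e a.+1 b))).
  exact: ler_pM.
by rewrite eS mulrACA powR_mulB.
Qed.

(** The same descent in the second variable, started from the axis instead of the origin: the value
    at [(u.1, 0)] is already controlled by [axis]. *)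
Let plane n b : e 0 b <= n%:R * k2 -> exists2 C, 0 <= C & forall r, 0 < r <= 1 ->
  forall u, `|u.1| <= eta * r `^ k1 -> `|u.2| <= eta * r `^ k2 ->
  `|F 0 b u| <= C * r `^ e 0 b.
Proof.
have inbox r (u : R2 R) : 0 < r <= 1 -> `|u.1| <= eta * r `^ k1 ->
    `|u.2| <= eta * r `^ k2 -> `|u| <= eta.
  move=> r01 u1 u2; rewrite norm_pair_le; apply/andP; split.
    by apply: le_trans u1 _; exact: powR_le1_scale.
  by apply: le_trans u2 _; exact: powR_le1_scale.
elim: n b => [|n IH] b.
  rewrite mul0r => /base[C C0 H]; exists C => // r r01 u u1 u2; apply: H => //.
  exact: inbox u2.
have [e0 _|e0 en] := leP (e 0 b) 0.
  have [C C0 H] := base e0; exists C => // r r01 u u1 u2; apply: H => //.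
  exact: inbox u2.
have eS : e 0 b.+1 = e 0 b - k2 by rewrite /e -natr1; ring.
have [|C C0 H] := IH b.+1; first by move: en; rewrite eS -natr1; lra.
have [C' C'0 H'] : exists2 C, 0 <= C & forall r, 0 < r <= 1 ->
  forall t, `|t| <= eta * r `^ k1 -> `|F 0 b (t, 0)| <= C * r `^ e 0 b.
  apply: (@axis (Num.truncn (e 0 b / k1)).+1).
  by rewrite -ler_pdivrMr// ltW// truncnS_gt.
exists (C' + eta * C); first by rewrite addr_ge0// mulr_ge0 ?(ltW eta0).
move=> r r01 u u1 u2; have [r0 r1] := andP r01.
have vE (s : R) : (u.1, 0) + s *: (0, 1) = (u.1, s) :> R2 R.
  by congr pair; rewrite /= /GRing.scale /=; ring.
have [|s st] := @MVT_line R (R2 R) (F 0 b) (u.1, 0) (0, 1) u.2.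
  move=> s st; have [_ /(_ (0, 1))[+ _]] := smoothF 0 b 1%N; apply.
  by apply: etaD; rewrite vE; apply: (inbox r) => //=; exact: le_trans u2.
rewrite !vE -surjective_pairing => /eqP; rewrite subr_eq => /eqP ->.
rewrite addrC mulrDl (le_trans (ler_normD _ _))// lerD ?H'// normrM.
have := H r r01 (u.1, s) u1 (le_trans st u2).
rewrite -[X in X -> _]/(is_true (`|'D_(0, 1) (F 0 b) (u.1, s)| <= _)) => Hs.
apply: (@le_trans _ _ ((eta * r `^ k2) * (C * r `^ e 0 b.+1))).
  exact: ler_pM.
by rewrite eS mulrACA powR_mulB.
Qed.

Lemma weighted_decay : exists2 C, 0 <= C & forall r, 0 < r <= 1 ->
  forall u, `|u.1| <= eta * r `^ k1 -> `|u.2| <= eta * r `^ k2 ->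
  `|g u| <= C * r `^ d.
Proof.
have E : e 0 0 = d by rewrite /e; ring.
have [|C C0 H] := @plane (Num.truncn (e 0 0 / k2)).+1 0.
  by rewrite -ler_pdivrMr// ltW// truncnS_gt.
by exists C => // r r01 u u1 u2; have := H r r01 u u1 u2; rewrite E.
Qed.

End decay.

(** * Integrals bounded below by step functions, and measures bounded by slicing *)

Section integral_lower_bounds.
Local Open Scope ereal_scope.
Context d (T : measurableType d) {R : realType} (mu : {measure set T -> \bar R}).

(* No measurability is needed: the integral of a nonnegative function is the
   supremum of the integrals of the simple functions below it. *)
Lemma ge0_integral_mono (f g : T -> \bar R) :
  (forall x, 0 <= f x) -> (forall x, f x <= g x) ->
  \int[mu]_x f x <= \int[mu]_x g x.
Proof.
move=> f0 fg; have g0 x : 0 <= g x by apply: le_trans (fg x).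
rewrite !ge0_integralTE//; apply: le_ereal_sup => _ [h /= hf <-].
by exists h => // x; apply: le_trans (fg x).
Qed.

(** The integrand extended by zero dominates the step function with value [c k] on [A k]; by
    disjointness at most one term is nonzero at each point. Only pointwise bounds on [g] enter. *)
Lemma integral_ge_sum (D : set T) (g : T -> \bar R) (N : nat) (c : nat -> R)
    (A : nat -> set T) :
  (forall k, measurable (A k)) -> (forall k, A k `<=` D) ->
  trivIset setT A -> (forall k, (0 <= c k)%R) ->
  (forall x, D x -> 0 <= g x) ->
  (forall k x, (k < N)%N -> A k x -> (c k)%:E <= g x) ->
  \sum_(k < N) (c k)%:E * mu (A k) <= \int[mu]_(x in D) g x.
Proof.
move=> mA AD tA c0 g0 cg; rewrite integral_mkcond.
pose f k x : \bar R := (c k)%:E * (\1_(A k) x)%:E.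
have f0 k x : 0 <= f k x by rewrite mule_ge0// lee_fin.
have mf k : measurable_fun setT (f k).
  by apply: measurable_funeM; exact/measurable_EFinP.
apply: (@le_trans _ _ (\int[mu]_x \sum_(k < N) f k x)).
  rewrite ge0_integral_sum//.
  rewrite le_eqVlt; apply/orP; left; apply/eqP; apply: eq_bigr => k _.
  rewrite /f ge0_integralZl_EFin//; first by rewrite integral_indic// setIT.
  exact/measurable_EFinP.
apply: (@ge0_integral_mono (fun x => \sum_(k < N) f k x) (g \_ D)) => x.
  by apply: sume_ge0 => k _.
rewrite /patch; have g'0 : 0 <= if x \in D then g x else 0.
  by case: ifPn => // /set_mem; exact: g0.
have [[k kN Akx]|H] := pselect (exists2 k, (k < N)%N & A k x).
  rewrite (bigD1 (Ordinal kN))//= big1 ?adde0; last first.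
    move=> j jk; rewrite /f indicE memNset ?mule0// => Ajx.
    move/eqP: jk; apply; apply/val_inj => /=.
    by apply: tA => //; exists x.
  by rewrite /f indicE mem_set// mule1 mem_set ?cg//; exact: AD Akx.
rewrite big1// => k _; rewrite /f indicE memNset ?mule0// => Akx.
by apply: H; exists k.
Qed.

Lemma integral_ge_cst (D A : set T) (g : T -> \bar R) (c : R) :
  measurable A -> A `<=` D -> (0 <= c)%R ->
  (forall x, D x -> 0 <= g x) -> (forall x, A x -> c%:E <= g x) ->
  c%:E * mu A <= \int[mu]_(x in D) g x.
Proof.
move=> mA AD c0 g0 cg.
pose B k := if k is 0%N then A else set0.
have := @integral_ge_sum D g 1 (fun=> c) B.
rewrite big_ord1; apply => //.
- by case=> [|k] //=; exact: measurable0.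
- by case=> [|k] //=; exact: sub0set.
- by move=> [|i] [|j] _ _ //= [x []].
- by move=> [|k] x //= _; exact: cg.
Qed.

End integral_lower_bounds.

Section product_sections.
Local Open Scope ereal_scope.
Context d1 d2 (T1 : measurableType d1) (T2 : measurableType d2) {R : realType}.
Variable m1 : {measure set T1 -> \bar R}.
Variable m2 : {sigma_finite_measure set T2 -> \bar R}.

Lemma product_measure_xsection_le (A : set (T1 * T2)) (B : set T1) (c : R) :
  (0 <= c)%R -> measurable A -> measurable B ->
  (forall x y, A (x, y) -> B x) -> (forall x, m2 (xsection A x) <= c%:E) ->
  (m1 \x m2) A <= c%:E * m1 B.
Proof.
move=> c0 mA mB AB Ac; rewrite /product_measure1.
apply: (@le_trans _ _ (\int[m1]_x (c%:E * (\1_B x)%:E))).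
  apply: ge0_integral_mono => x //=.
  have [Bx|Bx] := pselect (B x); first by rewrite indicE mem_set// mule1.
  rewrite indicE memNset// mule0 (_ : xsection A x = set0) ?measure0//.
  by apply/seteqP; split => // y; rewrite /xsection /= => /set_mem/AB/Bx.
rewrite ge0_integralZl_EFin ?integral_indic ?setIT//.
exact/measurable_EFinP.
Qed.

(** The product measure is defined by integrating x-sections, so slicing in the other variable goes
    through Tonelli for the indicator of [A]. *)
Lemma product_measure_ysection_le (m3 : {sigma_finite_measure set T1 -> \bar R})
    (A : set (T1 * T2)) (B : set T2) (c : R) :
  (0 <= c)%R -> measurable A -> measurable B ->
  (forall x y, A (x, y) -> B y) -> (forall y, m3 (ysection A y) <= c%:E) ->
  (m3 \x m2) A <= c%:E * m2 B.
Proof.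
move=> c0 mA mB AB Ac.
have -> : (m3 \x m2) A = \int[m2]_y m3 (ysection A y).
  have := @indic_fubini_tonelli _ _ _ _ _ m3 m2 A mA.
  by rewrite indic_fubini_tonelli_FE// indic_fubini_tonelli_GE.
apply: (@le_trans _ _ (\int[m2]_x (c%:E * (\1_B x)%:E))).
  apply: ge0_integral_mono => x //=.
  have [Bx|Bx] := pselect (B x); first by rewrite indicE mem_set// mule1.
  rewrite indicE memNset// mule0 (_ : ysection A x = set0) ?measure0//.
  by apply/seteqP; split => // y; rewrite /ysection /= => /set_mem/AB/Bx.
rewrite ge0_integralZl_EFin ?integral_indic ?setIT//.
exact/measurable_EFinP.
Qed.

End product_sections.

(** * Lebesgue measure in dimensions two and three *)

Section borel3.
Context {R : realType}.

(** An open set is the countable union of the boxes with rational centre and radius [1 / (n + 1)]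
    that it contains, and such boxes are products of intervals. This links the topology to the
    product sigma-algebra. *)
Lemma open_measurable3 (U : set (R3 R)) : open U -> measurable (U : set (mR3 R)).
Proof.
move=> oU.
pose box (i : rat * rat * rat * nat) : set (R3 R) :=
  ball ((ratr i.1.1.1, ratr i.1.1.2, ratr i.1.2) : R3 R) (i.2.+1%:R^-1).
have mbox i : measurable (box i : set (mR3 R)).
  have -> : box i = ((ball (ratr i.1.1.1 : R) i.2.+1%:R^-1 `*`
     ball (ratr i.1.1.2 : R) i.2.+1%:R^-1) `*` ball (ratr i.1.2 : R) i.2.+1%:R^-1).
    by apply/seteqP; split.
  by apply: measurableX; [apply: measurableX|]; exact: measurable_ball.
pose F i : set (mR3 R) := [set x | box i x /\ box i `<=` U].
have -> : U = \bigcup_i F i.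
  apply/seteqP; split => [x Ux|x [i _ [bx bU]]]; last exact: bU.
  have /nbhs_ballP[e /= e0 eU] : nbhs x U by exact: open_nbhs_nbhs.
  pose n := Num.truncn (2 / e).
  have ne : 2 / n.+1%:R < e.
    by rewrite ltr_pdivrMr ?ltr0n// mulrC -ltr_pdivrMr// truncnS_gt.
  have n0 : 0 < n.+1%:R^-1 :> R by rewrite invr_gt0 ltr0n.
  have rat_near (y : R) : exists q : rat, `|ratr q - y| < n.+1%:R^-1.
    have lt : y - n.+1%:R^-1 < y + n.+1%:R^-1 by rewrite ltrD2l gtrN.
    have [q] := rat_in_itvoo lt; rewrite in_itv /= => /andP[q1 q2]; exists q.
    by rewrite ltr_norml ltrBrDl q1 ltrBlDl q2.
  have [q1 Q1] := rat_near x.1.1; have [q2 Q2] := rat_near x.1.2.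
  have [q3 Q3] := rat_near x.2.
  exists (q1, q2, q3, n) => //; split.
    by rewrite /box -ball_normE /= !norm_pair_lt /= Q1 Q2 Q3.
  move=> y; rewrite /box -ball_normE /= !norm_pair_lt /= => /andP[/andP[y1 y2] y3].
  apply: eU; rewrite -ball_normE /= !norm_pair_lt /=.
  have tri (u v t w : R) : `|v - u| < w -> `|v - t| < w -> 2 * w < e -> `|u - t| < e.
    rewrite distrC => h1 h2 we; apply: le_lt_trans (ler_distD v _ _) _.
    by apply: lt_trans we; lra.
  by rewrite (tri _ _ _ _ Q1 y1 ne) (tri _ _ _ _ Q2 y2 ne) (tri _ _ _ _ Q3 y3 ne).
apply: countable_bigcupT_measurable => // i.
have [bU|bU] := pselect (box i `<=` U).
  rewrite (_ : F i = box i)//.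
  by apply/seteqP; split => [x []|x].
rewrite (_ : F i = set0)//; by apply/seteqP; split => [x []|x].
Qed.

Lemma closed_measurable3 (K : set (R3 R)) :
  closed K -> measurable (K : set (mR3 R)).
Proof.
move=> cK; rewrite -[K]setCK; apply: measurableC.
by apply: open_measurable3; apply: closed_openC.
Qed.

Lemma compact_measurable3 (K : set (R3 R)) :
  compact K -> measurable (K : set (mR3 R)).
Proof.
move=> /compact_closed cK; apply: closed_measurable3.
by apply: cK; exact: norm_hausdorff.
Qed.

Lemma lebesgue2_rect (a1 b1 a2 b2 : R) : a1 <= b1 -> a2 <= b2 ->
  lebesgue2 R (`[a1, b1] `*` `[a2, b2]) = ((b1 - a1) * (b2 - a2))%:E.
Proof.
move=> ab1 ab2; rewrite [LHS]product_measure1E; try exact: measurable_itv.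
have H (a b : R) : a <= b -> lebesgue_measure `[a, b] = (b - a)%:E.
  rewrite lebesgue_measure_itv /= lte_fin le_eqVlt => /orP[/eqP ->|-> //].
  by rewrite ltxx subrr.
by rewrite EFinM; congr (_ * _)%E; exact: H.
Qed.

Lemma lebesgue3_ball (x : R3 R) (e : R) : 0 <= e ->
  lebesgue3 R (ball x e) = ((2 * e) ^+ 3)%:E.
Proof.
move=> e0.
have -> : ball x e = (ball x.1.1 e `*` ball x.1.2 e) `*` ball x.2 e.
  by apply/seteqP; split.
rewrite [LHS]product_measure1E; last 2 first.
- by apply: measurableX; exact: measurable_ball.
- exact: measurable_ball.
rewrite [X in (X * _)%E]product_measure1E; try exact: measurable_ball.
have H (y : R) : lebesgue_measure (ball y e) = (2 * e)%:E.
  by rewrite mulr_natl; exact: lebesgue_measure_ball.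
by rewrite exprSr expr2 !EFinM; congr (_ * _ * _)%E; exact: H.
Qed.

End borel3.

Section slabs.
Context {R : realType}.
Local Notation mR := (measurableTypeR R).

Lemma slab1E (a s e : R) : a != 0 -> [set x : R | `|a * x + s| <= e] =
  `[- s / a - e / `|a|, - s / a + e / `|a|]%classic.
Proof.
move=> a0; have na : 0 < `|a| by rewrite normr_gt0.
have E x : (`|a * x + s| <= e) = (`|x - (- s / a)| <= e / `|a|).
  rewrite ler_pdivlMr// -normrM; congr (`|_| <= _).
  by rewrite mulrBl divfK// opprK mulrC.
by apply/seteqP; split => x /=; rewrite in_itv /= -ler_distl E.
Qed.

Lemma measurable_slab1 (a s e : R) : a != 0 ->
  measurable ([set x | `|a * x + s| <= e] : set mR).
Proof. by move=> a0; rewrite slab1E//; exact: measurable_itv. Qed.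

Lemma slab1_le (a s e : R) : a != 0 -> 0 <= e ->
  (lebesgue_measure [set x : R | `|a * x + s| <= e]%R <= (2 * e / `|a|)%:E)%E.
Proof.
move=> a0 e0.
have na : 0 < `|a| by rewrite normr_gt0.
rewrite slab1E//.
rewrite lebesgue_measure_itv /= lte_fin; case: ifPn => _; last first.
  by rewrite lee_fin divr_ge0 ?mulr_ge0// ltW.
by rewrite lee_fin le_eqVlt; apply/orP; left; apply/eqP; ring.
Qed.

Lemma continuous_linear3 (a b c : R) :
  continuous (fun x : R3 R => a * x.1.1 + b * x.1.2 + c * x.2).
Proof.
move=> x; have c1 : (fun x : R3 R => x.1) @ x --> x.1 by exact: cvg_fst.
apply: cvgD; last by apply: cvgMl_tmp; exact: cvg_snd.
apply: cvgD; apply: cvgMl_tmp.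
  by apply: (cvg_comp _ _ c1); exact: cvg_fst.
by apply: (cvg_comp _ _ c1); exact: cvg_snd.
Qed.

Lemma closed_slab3 (a b c s e : R) :
  closed [set x : R3 R | `|a * x.1.1 + b * x.1.2 + c * x.2 + s| <= e].
Proof.
apply: (@closed_comp _ _ (fun x : R3 R => `|a * x.1.1 + b * x.1.2 + c * x.2 + s|)
  [set y | y <= e]); last exact: closed_le.
move=> x _; apply: (@cvg_norm _ _ _ (nbhs x)); apply: cvgD; last exact: cvg_cst.
exact: continuous_linear3.
Qed.

Definition slab2 (a b K s e : R) : set (R2 R) :=
  [set u | [/\ `|u.1| <= K, `|u.2| <= K & `|a * u.1 + b * u.2 + s| <= e]].

Lemma measurable_slab2 (a b K s e : R) :
  measurable (slab2 a b K s e : set (mR2 R)).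
Proof.
(* The planar slab is the section at height 0 of a closed subset of space, to which measurability of
   closed sets applies. *)
have -> : slab2 a b K s e =
  ysection (([set x | `|1 * x.1.1 + 0 * x.1.2 + 0 * x.2 + 0| <= K] `&`
   ([set x | `|0 * x.1.1 + 1 * x.1.2 + 0 * x.2 + 0| <= K] `&`
   [set x | `|a * x.1.1 + b * x.1.2 + 0 * x.2 + s| <= e])) : set (mR3 R)) 0.
  apply/seteqP; split => u; rewrite /ysection /= in_setE /= !mul1r !mul0r !addr0 ?add0r.
    by case=> *; split=> //; split.
  by case=> ? [].
apply: measurable_ysection; apply: measurableI; last apply: measurableI;
  apply: closed_measurable3; exact: closed_slab3.
Qed.

(** Slices along a variable with nonzero coefficient are contained in intervals of length [2 * e]
    over the absolute value of that coefficient; the other variable ranges over an interval of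
    length [2 * K]. *)
Lemma slab2_le (a b K : R) : a != 0 \/ b != 0 -> 0 <= K ->
  exists2 C, 0 <= C & forall s e, 0 <= e ->
  (lebesgue2 R (slab2 a b K s e) <= (C * e)%:E)%E.
Proof.
move=> ab0 K0.
have mB : measurable (`[- K, K]%classic : set mR) by exact: measurable_itv.
have lB : lebesgue_measure (`[- K, K]%classic : set mR) = (2 * K)%:E.
  rewrite lebesgue_measure_itv /= lte_fin; case: ifPn => [_|].
    by rewrite -EFinB; congr EFin; ring.
  by rewrite -leNgt => ?; congr EFin; lra.
case: ab0 => [a0|b0].
- exists (2 / `|a| * (2 * K)); first by rewrite !mulr_ge0 ?invr_ge0.
  move=> s e e0.
  have -> : (2 / `|a| * (2 * K) * e)%:E = ((2 * e / `|a|)%:E * (2 * K)%:E)%E.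
    by rewrite -EFinM; congr EFin; ring.
  rewrite -lB; apply: (@product_measure_ysection_le _ _ mR mR R lebesgue_measure lebesgue_measure
    _ _ _ _ (measurable_slab2 a b K s e) mB).
  + by rewrite divr_ge0 ?mulr_ge0.
  + by rewrite /slab2 => x y [] _ /=; rewrite in_itv /= ler_norml.
  + move=> y; apply: le_trans (slab1_le (b * y + s) a0 e0).
    apply: le_measure; rewrite ?inE.
    * by apply: measurable_ysection; exact: measurable_slab2.
    * exact: measurable_slab1.
    * by move=> x; rewrite /ysection /slab2 /= in_setE => -[_ _] /=; rewrite addrA.
- exists (2 / `|b| * (2 * K)); first by rewrite !mulr_ge0 ?invr_ge0.
  move=> s e e0.
  have -> : (2 / `|b| * (2 * K) * e)%:E = ((2 * e / `|b|)%:E * (2 * K)%:E)%E.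
    by rewrite -EFinM; congr EFin; ring.
  rewrite -lB; apply: (@product_measure_xsection_le _ _ mR mR R lebesgue_measure lebesgue_measure
    _ _ _ _ (measurable_slab2 a b K s e) mB).
  + by rewrite divr_ge0 ?mulr_ge0.
  + by rewrite /slab2 => x y [] /=; rewrite in_itv /= ler_norml.
  + move=> y; apply: le_trans (slab1_le (a * y + s) b0 e0).
    apply: le_measure; rewrite ?inE.
    * by apply: measurable_xsection; exact: measurable_slab2.
    * exact: measurable_slab1.
    * by move=> x; rewrite /xsection /slab2 /= in_setE => -[_ _] /=; rewrite addrA [b * _ + _]addrC.
Qed.

Definition slab (a b c K e : R) : set (R3 R) :=
  [set x | [/\ `|x.1.1| <= K, `|x.1.2| <= K, `|x.2| <= K &
    `|a * x.1.1 + b * x.1.2 + c * x.2| <= e]].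

Lemma measurable_slab (a b c K e : R) : measurable (slab a b c K e : set (mR3 R)).
Proof.
have -> : slab a b c K e = [set x | `|1 * x.1.1 + 0 * x.1.2 + 0 * x.2 + 0| <= K] `&`
     ([set x | `|0 * x.1.1 + 1 * x.1.2 + 0 * x.2 + 0| <= K] `&`
     ([set x | `|0 * x.1.1 + 0 * x.1.2 + 1 * x.2 + 0| <= K] `&`
     [set x | `|a * x.1.1 + b * x.1.2 + c * x.2 + 0| <= e])).
  apply/seteqP; split => u; rewrite /slab /= !mul1r !mul0r !addr0 ?add0r.
    by case=> *; do 3?split=> //.
  by case=> ? [? []].
by repeat apply: measurableI; apply: closed_measurable3; exact: closed_slab3.
Qed.

(** If [c] is nonzero, one slices in the third variable. If [c = 0], the slab is contained in the
    product of a planar slab and an interval. *)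
Lemma slab_le (a b c K : R) : [\/ a != 0, b != 0 | c != 0] -> 0 <= K ->
  exists2 C, 0 <= C & forall e, 0 <= e ->
  (lebesgue3 R (slab a b c K e) <= (C * e)%:E)%E.
Proof.
move=> abc0 K0.
have [c0|c0] := eqVneq c 0.
  have ab0 : a != 0 \/ b != 0.
    by case: abc0 => [?|?|]; [left|right|rewrite c0 eqxx].
  have [C C0 H] := slab2_le ab0 K0.
  exists (C * (2 * K)); first by rewrite !mulr_ge0.
  move=> e e0.
  have -> : (C * (2 * K) * e)%:E = ((C * e)%:E * (2 * K)%:E)%E.
    by rewrite -EFinM; congr EFin; ring.
  have <- : lebesgue_measure (`[- K, K]%classic : set mR) = (2 * K)%:E.
    rewrite lebesgue_measure_itv /= lte_fin; case: ifPn => [_|].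
      by rewrite -EFinB; congr EFin; ring.
    by rewrite -leNgt => ?; congr EFin; lra.
  apply: (@le_trans _ _ (lebesgue3 R (slab2 a b K 0 e `*` `[- K, K]%classic))).
    apply: le_measure; rewrite ?inE.
    - exact: measurable_slab.
    - by apply: measurableX; [exact: measurable_slab2|exact: measurable_itv].
    - move=> [u y] [/= h1 h2 h3 h4]; split; last by rewrite /= in_itv /= -ler_norml.
      by split => //; move: h4; rewrite c0 mul0r.
  rewrite [X in (X <= _)%E]product_measure1E; last 2 first.
  - exact: measurable_slab2.
  - exact: measurable_itv.
  by apply: lee_pmul => //; apply: H.
have m2 : lebesgue2 R (`[- K, K] `*` `[- K, K]) = ((2 * K) * (2 * K))%:E.
  by rewrite lebesgue2_rect ?gerN_le//; [congr EFin; ring| lra| lra].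
exists (2 / `|c| * (2 * K * (2 * K))); first by rewrite !mulr_ge0 ?invr_ge0.
move=> e e0.
have -> : (2 / `|c| * (2 * K * (2 * K)) * e)%:E =
    ((2 * e / `|c|)%:E * (2 * K * (2 * K))%:E)%E.
  by rewrite -EFinM; congr EFin; ring.
rewrite -m2; apply: (@product_measure_xsection_le _ _ (mR2 R) mR R
    (lebesgue2 R) lebesgue_measure _ _ _ _ (measurable_slab a b c K e)).
- by rewrite divr_ge0 ?mulr_ge0.
- by apply: measurableX; exact: measurable_itv.
- by move=> x y [] /= h1 h2 _ _; split; rewrite /= in_itv /= -ler_norml.
- move=> y; apply: le_trans (slab1_le (a * y.1 + b * y.2) c0 e0).
  apply: le_measure; rewrite ?inE.
  + by apply: measurable_xsection; exact: measurable_slab.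
  + exact: measurable_slab1.
  + by move=> x; rewrite /xsection /slab /= in_setE => -[_ _ _] /=; rewrite [c * _ + _]addrC.
Qed.

End slabs.

(** * Surface patches *)

Section vector_valued.
Context {R : realType}.

Lemma C1_differentiable2 (D : set (R2 R)) (g : R2 R -> R2 R) (x : R2 R) :
  open D -> D x -> Ck_on 1 D g -> differentiable g x.
Proof.
move=> oD Dx Cg.
have -> : g = (fun u => ((g u).1, (g u).2)).
  by apply/funext => u; rewrite -surjective_pairing.
apply: differentiable_pair.
  apply: (C1_differentiable oD Dx).
  by apply: (Ck_on_linear_comp oD _ Cg (L := fst)) => y; exact: cvg_fst.
apply: (C1_differentiable oD Dx).
by apply: (Ck_on_linear_comp oD _ Cg (L := snd)) => y; exact: cvg_snd.
Qed.

Lemma C1_differentiable3 (D : set (R2 R)) (g : R2 R -> R3 R) (x : R2 R) :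
  open D -> D x -> Ck_on 1 D g -> differentiable g x.
Proof.
move=> oD Dx Cg.
have -> : g = (fun u => ((g u).1, (g u).2)).
  by apply/funext => u; rewrite -surjective_pairing.
apply: differentiable_pair.
  apply: (C1_differentiable2 oD Dx).
  by apply: (Ck_on_linear_comp oD _ Cg (L := fst)) => y; exact: cvg_fst.
apply: (C1_differentiable oD Dx).
by apply: (Ck_on_linear_comp oD _ Cg (L := snd)) => y; exact: cvg_snd.
Qed.

Lemma linear3E (L : {linear R3 R -> R3 R}) (x : R3 R) :
  L x = x.1.1 *: L (1, 0, 0) + x.1.2 *: L (0, 1, 0) + x.2 *: L (0, 0, 1).
Proof.
rewrite -!linearZ -!linearD; congr (L _).
by case: x => [[a b] c]; congr (_, _, _); rewrite /= /GRing.scale /=; ring.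
Qed.

Lemma continuous_linear3_map (L : {linear R3 R -> R3 R}) : continuous L.
Proof.
have -> : (L : R3 R -> R3 R) = (fun x =>
    x.1.1 *: L (1, 0, 0) + x.1.2 *: L (0, 1, 0) + x.2 *: L (0, 0, 1)).
  by apply/funext => x; exact: linear3E.
move=> x; have c1 : (fun x : R3 R => x.1) @ x --> x.1 by exact: cvg_fst.
apply: cvgD; last by apply: cvgZr_tmp; exact: cvg_snd.
apply: cvgD; apply: cvgZr_tmp.
  by apply: (cvg_comp _ _ c1); exact: cvg_fst.
by apply: (cvg_comp _ _ c1); exact: cvg_snd.
Qed.

Lemma dot3_eq0 (v : R3 R) : dot3 v v <= 0 -> v = 0.
Proof.
case: v => [[a b] c]; rewrite /dot3 /= -!expr2 => H.
have a0 := sqr_ge0 a; have b0 := sqr_ge0 b; have c0 := sqr_ge0 c.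
have E (z : R) : z ^+ 2 <= 0 -> z = 0.
  by move=> z0; apply/eqP; rewrite -sqrf_eq0 eq_le z0 sqr_ge0.
by congr (_, _, _); apply: E; lra.
Qed.

(** [w] is [dot3 u u] times the component of [v] orthogonal to [u], so a vanishing Gram determinant
    exhibits a linear relation between [u] and [v]. *)
Lemma dot3_gram (u v : R3 R) (w := - dot3 u v *: u + dot3 u u *: v) :
  dot3 w w = dot3 u u * (dot3 u u * dot3 v v - dot3 u v ^+ 2).
Proof.
rewrite /w {w}; case: u v => [[a b] c] [[a' b'] c'].
by rewrite /dot3 /= /GRing.scale /=; ring.
Qed.

(** If the Gram determinant were not positive, the vector of the Gram identity would vanish. It is
    the derivative of [P] in the direction [(- dot3 d1 d2, dot3 d1 d1)], so injectivity gives
    [d1 = 0], against injectivity in the direction [(1, 0)]. *)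
Lemma area_density_gt0 (P : R2 R -> R3 R) (x : R2 R) : differentiable P x ->
  (forall v : R2 R, 'D_v P x = 0 -> v = 0) -> 0 < area_density P x.
Proof.
move=> dP inj; rewrite /area_density.
set d1 := 'D_(1, 0) P x; set d2 := 'D_(0, 1) P x.
rewrite sqrtr_gt0 ltNge; apply/negP => H.
have lin (a b : R) : 'D_((a, b) : R2 R) P x = a *: d1 + b *: d2.
  rewrite /d1 /d2 !(deriveE _ dP) -!linearZ -linearD /=; congr ('d P x _).
  by congr pair; rewrite /= /GRing.scale /=; ring.
have E0 : 0 <= dot3 d1 d1.
  by rewrite /dot3 !addr_ge0// -expr2 sqr_ge0.
have z0 : - dot3 d1 d2 *: d1 + dot3 d1 d1 *: d2 = 0.
  apply: dot3_eq0.
  rewrite dot3_gram.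
  by rewrite mulr_ge0_le0.
have [_ E] := inj _ (etrans (lin _ _) z0).
have d10 : d1 = 0 by apply: dot3_eq0; rewrite E.
have /(congr1 fst)/= := inj (1, 0) d10.
by move/eqP; rewrite oner_eq0.
Qed.

Lemma continuous_dot3 (T : topologicalType) (f g : T -> R3 R) (x : T) :
  {for x, continuous f} -> {for x, continuous g} ->
  {for x, continuous (fun u => dot3 (f u) (g u))}.
Proof.
move=> cf cg; rewrite /dot3.
have c1 (h : T -> R3 R) : {for x, continuous h} -> (fun u => (h u).1) @ x --> (h x).1.
  by move=> ch; apply: (cvg_comp _ _ ch); exact: cvg_fst.
have c11 (h : T -> R3 R) : {for x, continuous h} -> (fun u => (h u).1.1) @ x --> (h x).1.1.
  by move=> /c1 ch; apply: (cvg_comp _ _ ch); exact: cvg_fst.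
have c12 (h : T -> R3 R) : {for x, continuous h} -> (fun u => (h u).1.2) @ x --> (h x).1.2.
  by move=> /c1 ch; apply: (cvg_comp _ _ ch); exact: cvg_snd.
have c2 (h : T -> R3 R) : {for x, continuous h} -> (fun u => (h u).2) @ x --> (h x).2.
  by move=> ch; apply: (cvg_comp _ _ ch); exact: cvg_snd.
apply: cvgD; last by apply: cvgM; exact: c2.
by apply: cvgD; apply: cvgM; first [exact: c11|exact: c12].
Qed.

Lemma continuous_area_density (P : R2 R -> R3 R) (x : R2 R) :
  {for x, continuous ('D_((1, 0) : R2 R) P)} ->
  {for x, continuous ('D_((0, 1) : R2 R) P)} ->
  {for x, continuous (area_density P)}.
Proof.
move=> c1 c2.
pose d (v w : R2 R) (u : R2 R) := dot3 ('D_v P u) ('D_w P u).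
pose E := d (1, 0) (1, 0); pose G := d (0, 1) (0, 1); pose F := d (1, 0) (0, 1).
have c11 : {for x, continuous E} := continuous_dot3 c1 c1.
have c22 : {for x, continuous G} := continuous_dot3 c2 c2.
have c12 : {for x, continuous F} := continuous_dot3 c1 c2.
have -> : area_density P = (fun u => Num.sqrt (E u * G u - F u * F u)).
  by apply/funext => u; rewrite /area_density expr2.
have c : (fun u => E u * G u - F u * F u) @ x --> E x * G x - F x * F x.
  exact: cvgB (cvgM c11 c22) (cvgM c12 c12).
exact: (cvg_comp _ _ c (@sqrt_continuous R _)).
Qed.

End vector_valued.

Lemma smooth_on_sub {R : realType} {V W : normedModType R} (D E : set V) (f : V -> W) :
  E `<=` D -> smooth_on D f -> smooth_on E f.
Proof. by move=> ED sf k; exact: Ck_on_sub (sf k). Qed.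

Section patch.
Context {R : realType} (S : set (R3 R)) (x0 : R3 R)
  (L : {linear R3 R -> R3 R}) (Omega : set (R2 R)) (phi : R2 R -> R)
  (LN : local_normalization S x0 L Omega phi)
  (Psi : R2 R -> R2 R) (LC : local_coordinates Psi).

(* Composing with [Psi] inside the graph parametrization avoids any change of
   variables in the surface integral. *)
Lemma patch_exists : exists (D : set (R2 R)) (P : R2 R -> R3 R),
  [/\ open D /\ D 0, smooth_on D Psi /\ smooth_on D (phi \o Psi),
     regular_patch S D P, P 0 = x0 &
     forall u, L (P u) = (Psi u, 1 + phi (Psi u))].
Proof.
case: LN => [[[Li LK KL] Lx0] [oO O0] sphi [phi0 dphi0] [V [_ EV]]].
case: LC => Psi0 [U [W [Phi [[oU U0] [oW W0] [sPsi sPhi] PhiK PsiK]]]].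
pose D := U `&` Psi @^-1` Omega.
have oD : open D.
  rewrite openE => u [Uu Ou]; apply: filterI; first exact: open_nbhs_nbhs.
  by apply: ((sPsi 0%N).1 _ Uu); exact: open_nbhs_nbhs.
have D0 : D 0 by split => //; rewrite /preimage /= Psi0.
have sPsiD : smooth_on D Psi by apply: smooth_on_sub sPsi => u [].
have spsiD : smooth_on D (phi \o Psi).
  by move=> k; apply: (Ck_on_comp2 oD oO) => // u [].
pose sc (w : R3 R) (r : R) : R3 R := r *: w.
have lsc w : linear (sc w) by move=> k a b; rewrite /sc scalerDl scalerA.
pose scL w : {linear R -> R3 R} := HB.pack (sc w) (GRing.isLinear.Build _ _ _ _ _ (lsc w)).
have csc w : continuous (scL w) by exact: scalel_continuous.
(* [P] is the inverse of [L] applied to [(Psi u, 1 + phi (Psi u))], written through the columns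
   [w1], [w2], [w3] of that inverse so that smoothness follows from sums and linear compositions. *)
pose w1 := Li (1, 0, 0); pose w2 := Li (0, 1, 0); pose w3 := Li (0, 0, 1).
pose P := (scL w1 \o (fst \o Psi)) + (scL w2 \o (snd \o Psi)) + (scL w3 \o (cst 1 + phi \o Psi)).
have LP u : L (P u) = (Psi u, 1 + phi (Psi u)).
  have -> : P u = (Psi u).1 *: w1 + (Psi u).2 *: w2 + (1 + phi (Psi u)) *: w3 by [].
  rewrite !linearD !linearZ /= /w1 /w2 /w3 !KL.
  by case: (Psi u) => a b; congr (_, _, _); rewrite /= /GRing.scale /=; ring.
have sP : smooth_on D P.
  move=> k; apply: (Ck_onD oD); first apply: (Ck_onD oD).
  - apply: (Ck_on_linear_comp oD) => //; apply: (Ck_on_linear_comp oD) => //.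
    by move=> y; exact: cvg_fst.
  - apply: (Ck_on_linear_comp oD) => //; apply: (Ck_on_linear_comp oD) => //.
    by move=> y; exact: cvg_snd.
  - apply: (Ck_on_linear_comp oD) => //; apply: (Ck_onD oD) => //.
    exact: Ck_on_cst.
have P0 : P 0 = x0.
  by rewrite -[LHS]LK LP Psi0 phi0 addr0 -[RHS]LK Lx0.
exists D, P; split => //; split => //.
- move=> _ [u [Uu Ou] <-].
  have : (L @` S `&` V) (Psi u, 1 + phi (Psi u)) by rewrite EV; exists (Psi u).
  by rewrite -LP => -[[y Sy /(can_inj LK) <-]].
- move=> u v /set_mem[Uu _] /set_mem[Uv _] /(congr1 L); rewrite !LP => -[E _].
  have [_ <-] := PhiK _ Uu; have [_ <-] := PhiK _ Uv.
  by rewrite [Psi u]surjective_pairing [Psi v]surjective_pairing E.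
(* If the derivative of [P] along [v] vanishes, so does that of [Psi], the first component of
   [L \o P]. As [Phi \o Psi] is the identity near [u], its derivative [v] is zero. *)
- move=> u Du v dP0; have [Uu _] := Du.
  have [_ /(_ v)[dP _]] := sP 1%N; have {}dP := dP _ Du.
  have dL : differentiable L (P u) by exact/linear_differentiable/continuous_linear3_map.
  have [ddLP dLP] := is_derive_comp dP dL.
  have dfst := is_derive_comp ddLP
    (@linear_differentiable _ _ _ fst (L (P u)) (fun y => cvg_fst)).
  have E : fst \o (L \o P) = Psi by apply/funext => y; rewrite /= LP.
  move: dfst; rewrite E dLP dP0 !linear0 => -[dPsi dPsi0].
  have dPhi : differentiable Phi (Psi u).
    by apply: (C1_differentiable2 oW _ (sPhi 1%N)); exact: (PhiK _ Uu).1.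
  have [_ dv] := is_derive_comp dPsi dPhi.
  rewrite -[v](derive_id u v) -[RHS](linear0 ('d Phi (Psi u))) -dPsi0 -dv.
  apply: near_eq_derive; near=> y; rewrite /= (PhiK _ _).2//.
  by near: y; exact: open_nbhs_nbhs.
Unshelve. all: by end_near. Qed.

End patch.

(** * Lower bound for averages over a patch *)

Section average.
Context {R : realType} (S : set (R3 R))
  (sigma : {measure set (mR3 R) -> \bar R}) (rho : R3 R -> R)
  (hsigma : is_surface_measure S sigma)
  (hrho : smooth_compactly_supported S rho)
  (hrho0 : forall y, S y -> 0 <= rho y)
  (x0 : R3 R) (Sx0 : S x0) (rhox0 : rho x0 != 0)
  (D : set (R2 R)) (P : R2 R -> R3 R)
  (rP : regular_patch S D P) (D0 : D 0) (P0 : P 0 = x0).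

Let oD : open D. Proof. by case: rP. Qed.
Let sP : smooth_on D P. Proof. by case: rP. Qed.
Let PS u : D u -> S (P u).
Proof. by case: rP => _ _ PS _ _ Du; apply: PS; exists u. Qed.
Let Pinj u v : D u -> D v -> P u = P v -> u = v.
Proof. by case: rP => _ _ _ inj _ Du Dv; apply: inj; exact/mem_set. Qed.

Lemma near_area_density : exists2 c : R, 0 < c &
  \forall u \near (0 : R2 R), c <= area_density P u.
Proof.
have a0 : 0 < area_density P 0.
  apply: area_density_gt0; last by case: rP => _ _ _ _; exact.
  exact: C1_differentiable3 (sP 1%N).
exists (area_density P 0 / 2); first by rewrite divr_gt0.
have [_ C1] := sP 1%N.
have [_ [c1 _]] := C1 (1, 0); have [_ [c2 _]] := C1 (0, 1).
have := continuous_area_density (c1 _ D0) (c2 _ D0).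
move/cvgrPdist_lt => /(_ (area_density P 0 / 2)); rewrite divr_gt0// => /(_ isT).
by apply: filterS => u; rewrite ltr_distlC => /andP[+ _] => /ltW; apply: le_trans; lra.
Qed.

Lemma near_density : exists2 c : R, 0 < c &
  \forall u \near (0 : R2 R), D u -> c <= rho (P u).
Proof.
have r0 : 0 < rho x0 by rewrite lt_def rhox0 hrho0.
have [U [g [oU Ux0 sg rg]]] := hrho.1 _ Sx0.
exists (rho x0 / 2); first by rewrite divr_gt0.
have cP : {for 0, continuous P} by exact: (sP 0%N).1.
have cg : {for 0, continuous (g \o P)}.
  by apply: continuous_comp => //; rewrite P0; exact: (sg 0%N).1.
have nU : \forall u \near (0 : R2 R), U (P u).
  by apply: cP; rewrite P0; exact: open_nbhs_nbhs.
have ng : \forall u \near (0 : R2 R), `|g (P 0) - g (P u)| < rho x0 / 2.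
  by move/cvgrPdist_lt : cg => /(_ (rho x0 / 2)); rewrite divr_gt0//; exact.
near=> u => Du.
have Uu : U (P u) by near: u.
rewrite (rg _ (PS Du) Uu).
have : `|g (P 0) - g (P u)| < rho x0 / 2 by near: u.
rewrite P0 -(rg x0)// ltr_distlC => /andP[+ _] => /ltW; apply: le_trans; lra.
Unshelve. all: by end_near. Qed.

Lemma patch_average : exists eta c : R, [/\ 0 < eta, 0 < c,
  (forall u : R2 R, `|u| <= eta -> D u) &
  forall (f : R3 R -> R) (x : R3 R) (t : R) (N : nat) (a : nat -> R)
    (A : nat -> set (R2 R)),
    (forall y, 0 <= f y) -> 0 < t -> (forall k, 0 <= a k) ->
    (forall k, compact (A k)) -> (forall k, measurable (A k : set (mR2 R))) ->
    (forall k u, A k u -> `|u| <= eta) -> trivIset setT A ->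
    (forall k u, (k < N)%N -> A k u -> a k <= f (x - t *: P u)) ->
  (\sum_(k < N) (c * a k)%:E * lebesgue2 R (A k) <=
     maximal_operator S sigma rho f x)%E].
Proof.
have [c1 c10 H1] := near_area_density; have [c2 c20 H2] := near_density.
have /nbhs_ballP[e /= e0 He] : nbhs (0 : R2 R)
    (D `&` ([set u | c1 <= area_density P u] `&` [set u | D u -> c2 <= rho (P u)])).
  by apply: filterI; [exact: open_nbhs_nbhs|exact: filterI].
have eta0 : 0 < e / 2 by rewrite divr_gt0.
have He' (u : R2 R) : `|u| <= e / 2 -> [/\ D u, c1 <= area_density P u & c2 <= rho (P u)].
  move=> ue; have : ball (0 : R2 R) e u.
    by rewrite -ball_normE /= sub0r normrN (le_lt_trans ue)//; lra.
  by case/He => Du [? ?]; split => //; auto.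
exists (e / 2), (c2 * c1); split => //; first by rewrite mulr_gt0.
  by move=> u /He'[].
move=> f x t N a A f0 t0 a0 cA mA Ae tA aA.
have AD k u : A k u -> D u by move=> /Ae/He'[].
have mB k : measurable (P @` A k : set (mR3 R)).
  apply: compact_measurable3; apply: continuous_compact => //.
  apply: continuous_in_subspaceT => u /set_mem Au.
  by apply: (sP 0%N).1; exact: AD Au.
have sB k : (c1%:E * lebesgue2 R (A k) <= sigma (P @` A k))%E.
  rewrite (hsigma rP (mB k)); last by move=> _ [u Au <-]; exists u => //; exact: AD Au.
  have -> : D `&` P @^-1` (P @` A k) = A k.
    apply/seteqP; split => [u [Du [v Av /Pinj <-//]]|u Au]; first exact: AD Av.
    by split; [exact: AD Au|exists u].
  apply: integral_ge_cst => //; first exact: ltW.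
  - by move=> u _; rewrite lee_fin sqrtr_ge0.
  - by move=> u /Ae/He'[_ h _] /=; rewrite lee_fin.
rewrite /maximal_operator.
apply: (@le_trans _ _ (\int[sigma]_(y in S) (f (x - t *: (y : R3 R)) * rho y)%:E)%E);
    last first.
  apply: le_trans (ereal_sup_ubound _); last by exists t.
  by rewrite gee0_abs//; apply: integral_ge0 => y Sy; rewrite lee_fin mulr_ge0// hrho0.
apply: (@le_trans _ _ (\sum_(k < N) (c2 * a k)%:E * sigma (P @` A k))%E).
  apply: lee_sum => k _.
  rewrite (_ : (c2 * c1 * a k)%:E = (c2 * a k)%:E * c1%:E)%E; last first.
    by rewrite -EFinM; congr EFin; ring.
  by rewrite -muleA; apply: lee_wpmul2l; [rewrite lee_fin mulr_ge0// ltW|exact: sB].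
apply: (@integral_ge_sum _ _ R sigma S _ N (fun k => c2 * a k) (fun k => P @` A k)) => //.
- by move=> k _ [u Au <-]; apply: PS; exact: AD Au.
- move=> i j _ _ [_ [[u Au <-] [v Av /Pinj E]]]; apply: tA => //; exists v; split => //.
  by rewrite E//; [exact: AD Av|exact: AD Au].
- by move=> k; rewrite mulr_ge0// ltW.
- by move=> y Sy; rewrite lee_fin mulr_ge0// hrho0.
- move=> k _ kN [u Au <-]; rewrite lee_fin [leRHS]mulrC.
  by apply: ler_pM => //; [exact: ltW|have [] := He' _ (Ae _ _ Au)|exact: aA].
Qed.

End average.

(** * From the norm inequality to an inequality between numbers *)

Section Lp_bounds.
Local Open Scope ereal_scope.
Context d (T : measurableType d) {R : realType} (mu : {measure set T -> \bar R}).
Variables (p : R) (f : T -> R) (B : R).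
Hypotheses (p1 : (1 <= p)%R) (f0 : forall x, (0 <= f x)%R)
  (mf : measurable_fun setT f) (fB : \int[mu]_x (f x `^ p)%:E <= B%:E).

Let fE : \int[mu]_x (`|(EFin \o f) x| `^ p) = \int[mu]_x (f x `^ p)%:E.
Proof.
by apply: eq_integral => x _; rewrite /= ger0_norm.
Qed.

Let p0 : (0 < p)%R. Proof. exact: lt_le_trans p1. Qed.

Lemma Lfun_of_integral_le : f \in Lfun mu p%:E.
Proof.
rewrite inE; apply/andP; split; first by rewrite inE.
rewrite inE /= /finite_norm unlock; apply: poweR_lty.
by rewrite fE (le_lt_trans fB)// ltry.
Qed.

Let ler_poweR (u v : \bar R) : 0 <= u -> u <= v -> u `^ p <= v `^ p.
Proof.
move=> u0 uv; have v0 := le_trans u0 uv.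
by apply: gt0_ler_poweR; rewrite ?in_itv /= ?u0 ?v0 ?leey// ltW.
Qed.

(** Chebyshev's inequality on [G] combined with the p-th power of the bound for the operator. The
    constant [C] may be negative, whence [|C|]. *)
Lemma Lnorm_le_measure (g : T -> \bar R) (C a m : R) (G : set T) :
  'N[mu]_p%:E[g] <= C%:E * 'N[mu]_p%:E[EFin \o f] ->
  measurable G -> mu G = m%:E -> (0 <= a)%R -> (forall x, G x -> a%:E <= g x) ->
  (a `^ p * m <= `|C| `^ p * B)%R.
Proof.
move=> NC mG Gm a0 ag.
have I0 : 0 <= \int[mu]_x (f x `^ p)%:E.
  by apply: integral_ge0 => x _; rewrite lee_fin powR_ge0.
have NE : ('N[mu]_p%:E[EFin \o f]) `^ p = \int[mu]_x (f x `^ p)%:E.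
  by rewrite poweR_Lnorm ?gt_eqF.
have N0 : 0 <= 'N[mu]_p%:E[EFin \o f] by exact: Lnorm_ge0.
have : ('N[mu]_p%:E[g]) `^ p <= (`|C|%:E * 'N[mu]_p%:E[EFin \o f]) `^ p.
  apply: ler_poweR; first exact: Lnorm_ge0.
  by apply: le_trans NC _; apply: lee_wpmul2r => //; rewrite lee_fin ler_norm.
rewrite poweRM//.
rewrite NE poweR_Lnorm ?gt_eqF// poweR_EFin => H.
rewrite -lee_fin !EFinM -Gm.
apply: (@le_trans _ _ (\int[mu]_x (`|g x| `^ p))).
  apply: integral_ge_cst => //; first exact: powR_ge0.
    by move=> x _; exact: poweR_ge0.
  move=> x Gx; rewrite -poweR_EFin; have agx := ag _ Gx.
  have a0' : 0 <= a%:E by rewrite lee_fin.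
  apply: ler_poweR => //.
  by rewrite gee0_abs// (le_trans a0').
by apply: le_trans H _; apply: lee_wpmul2l.
Qed.

End Lp_bounds.

(** * The exponents p > 1 *)

(** The maximum is used instead of the sum because the sets overlap: its p-th power is still at most
    the sum of the p-th powers [a k ^ p] over the sets [A k] containing the point. *)
Fixpoint stack {T : Type} {R : realType} (a : nat -> R) (A : nat -> set T) (N : nat)
    (x : T) : R :=
  if N is n.+1 then Num.max (stack a A n x) (a n * \1_(A n) x) else 0.

Lemma stack_ge0 {T : Type} {R : realType} (a : nat -> R) (A : nat -> set T) N x :
  0 <= stack a A N x.
Proof. by elim: N => [//|N IH] /=; rewrite le_max IH. Qed.

Lemma stack_ge {T : Type} {R : realType} (a : nat -> R) (A : nat -> set T) N k x :
  (k < N)%N -> A k x -> a k <= stack a A N x.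
Proof.
elim: N => [//|N IH]; rewrite ltnS leq_eqVlt => /orP[/eqP ->|kN] Ax /=.
  by rewrite le_max indicE mem_set// mulr1 lexx orbT.
by rewrite le_max IH.
Qed.

Lemma measurable_stack d (T : measurableType d) {R : realType} (a : nat -> R)
    (A : nat -> set T) N : (forall k, measurable (A k)) ->
  measurable_fun setT (stack a A N).
Proof.
move=> mA; elim: N => [|N IH] /=; first exact: measurable_cst.
by apply: measurable_maxr => //; apply: measurable_funM.
Qed.

Lemma integral_stack_le d (T : measurableType d) {R : realType}
    (mu : {measure set T -> \bar R}) (a : nat -> R) (A : nat -> set T) N (p B : R) :
  0 < p -> (forall k, measurable (A k)) -> (forall k, 0 <= a k) ->
  (forall k, (a k `^ p)%:E * mu (A k) <= B%:E)%E ->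
  (\int[mu]_x (stack a A N x `^ p)%:E <= (N%:R * B)%:E)%E.
Proof.
move=> p0 mA a0 aB; elim: N => [|N IH] /=.
  rewrite mul0r integral0_eq// => x _.
  by rewrite powR0// gt_eqF.
pose v x := a N `^ p * \1_(A N) x.
have vE x : (a N * \1_(A N) x) `^ p = v x.
  rewrite /v indicE; case: (x \in A N); rewrite ?mulr1 ?mulr0//.
  by rewrite powR0// gt_eqF.
have v0 x : 0 <= v x by rewrite mulr_ge0 ?powR_ge0.
have mv : measurable_fun setT (EFin \o v).
  by apply/measurable_EFinP; apply: measurable_funM.
have mu' : measurable_fun setT (fun x => (stack a A N x `^ p)%:E).
  apply/measurable_EFinP; apply: (measurableT_comp (measurable_powR p)).
  exact: measurable_stack.
apply: (@le_trans _ _ (\int[mu]_x ((stack a A N x `^ p)%:E + (v x)%:E))%E).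
  apply: ge0_integral_mono => x; first by rewrite lee_fin powR_ge0.
  rewrite -EFinD lee_fin -vE.
  have [_|_] := leP (stack a A N x) (a N * \1_(A N) x).
    by rewrite lerDr powR_ge0.
  by rewrite lerDl powR_ge0.
rewrite ge0_integralD//.
rewrite -natr1 mulrDl mul1r EFinD; apply: leeD => //.
apply: le_trans (aB N).
rewrite (_ : (\int[mu]_x (v x)%:E)%E = (\int[mu]_x ((a N `^ p)%:E * (\1_(A N) x)%:E))%E)//.
rewrite ge0_integralZl_EFin ?powR_ge0//; first by rewrite integral_indic// setIT.
- exact/measurable_EFinP.
- by move=> x _; rewrite lee_fin powR_ge0.
- by move=> x _; rewrite lee_fin.
Qed.

Lemma powR_superlinear {R : realType} (q0 Q p : R) : 0 < q0 -> 0 <= Q -> 1 < p ->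
  exists N : nat, Q * N%:R < q0 * N%:R `^ p.
Proof.
move=> q00 Q0 p1; have p10 : 0 < p - 1 by rewrite subr_gt0.
(* It suffices that [N^(p - 1)] exceed [Q / q0]; [N] is taken just above [z^(1 / (p - 1))]. *)
pose z := Q / q0 + 1; have z0 : 0 < z by rewrite ltr_wpDl// divr_ge0// ltW.
pose N := (Num.truncn (z `^ (p - 1)^-1)).+1; exists N.
have zN : z `^ (p - 1)^-1 < N%:R by exact: truncnS_gt.
have N0 : 0 < N%:R :> R by rewrite ltr0n.
have H : z <= N%:R `^ (p - 1).
  rewrite -[leLHS](powRr1 (ltW z0)) -[X in z `^ X](@mulVf _ (p - 1)) ?gt_eqF// powRrM.
  by apply: ge0_ler_powR; rewrite ?nnegrE ?powR_ge0 ?(ltW p10)// ltW.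
rewrite -(@mulr_powRB1 _ _ p) ?ltW//; last by rewrite (lt_trans _ p1).
rewrite [X in _ < X]mulrCA mulrC ltr_pM2l//.
apply: lt_le_trans (_ : q0 * z <= _); last by rewrite ler_pM2l.
by rewrite /z mulrDr mulr1 mulrC divfK ?gt_eqF// ltrDl.
Qed.

Section height_test.
Context {R : realType} (S : set (R3 R))
  (sigma : {measure set (mR3 R) -> \bar R}) (rho : R3 R -> R)
  (hsigma : is_surface_measure S sigma)
  (hrho : smooth_compactly_supported S rho)
  (hrho0 : forall y, S y -> 0 <= rho y)
  (x0 : R3 R) (Sx0 : S x0) (rhox0 : rho x0 != 0)
  (D : set (R2 R)) (P : R2 R -> R3 R)
  (rP : regular_patch S D P) (D0 : D 0) (P0 : P 0 = x0)
  (L : {linear R3 R -> R3 R}) (psi : R2 R -> R)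
  (LP : forall u, (L (P u)).2 = 1 + psi u) (Lx0 : (L x0).2 = 1)
  (spsi : smooth_on D psi) (p d k1 k2 : R)
  (k10 : 0 < k1) (k20 : 0 < k2) (k12 : k1 + k2 = 1)
  (dT : forall a, taylor_support psi a -> d <= k1 * a.1%:R + k2 * a.2%:R)
  (p1 : 1 < p) (hM : maximal_operator_bounded S sigma rho p%:E).

Let l (x : R3 R) : R := (L x).2.
Let al := l (1, 0, 0).
Let be := l (0, 1, 0).
Let ga := l (0, 0, 1).

Let lE x : l x = al * x.1.1 + be * x.1.2 + ga * x.2.
Proof. by rewrite /l linear3E /al /be /ga /l /= /GRing.scale /=; ring. Qed.

Let lZB x t y : l (x - t *: y) = l x - t * l y.
Proof. by rewrite /l linearB linearZ. Qed.

Let abc0 : [\/ al != 0, be != 0 | ga != 0].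
Proof.
have := lE x0; rewrite /l Lx0.
have [->|] := eqVneq al 0; last by constructor 1.
have [->|] := eqVneq be 0; last by constructor 2.
have [->|] := eqVneq ga 0; last by constructor 3.
by rewrite !mul0r !addr0 => /eqP; rewrite oner_eq0.
Qed.

Let r (k : nat) : R := 2^-1 ^+ k.

Let r0 k : 0 < r k. Proof. by rewrite exprn_gt0// invr_gt0. Qed.

Let r01 k : 0 < r k <= 1.
Proof. by rewrite r0 exprn_ile1// invf_le1 ?ler1n. Qed.

(** Centring at [(3 / 2) *: x0], where [l] equals [3 / 2], keeps the dilation [t = l x] positive and
    at most 2. *)
Lemma near_level : exists delta : R, 0 < delta /\
  forall x, ball ((3 / 2) *: x0) delta x -> 1 <= l x <= 2.
Proof.
have cl : {for (3 / 2) *: x0, continuous (fun x : R3 R => al * x.1.1 + be * x.1.2 + ga * x.2)}.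
  exact: continuous_linear3.
move/cvgrPdist_lt : cl => /(_ (1 / 2)); rewrite divr_gt0// => /(_ isT).
move=> /nbhs_ballP[e /= e0 He]; exists e; split => // x /He h.
have lx : l ((3 / 2) *: x0) = 3 / 2.
  by rewrite /l linearZ /= Lx0 /GRing.scale /= mulr1.
have : `|l ((3 / 2) *: x0) - l x| < 1 / 2 by rewrite !lE; exact: h.
rewrite lx ltr_distlC => /andP[h1 h2].
by apply/andP; split; lra.
Qed.

(** The midpoint between 1 and the ratio [2^(-k1)] of consecutive widths: above the ratio, so that
    rectangles of different scales are disjoint, and below 1, so that each keeps a fixed share of
    its width. *)
Let m : R := (1 + 2^-1 `^ k1) / 2.

Let q1 : 2^-1 `^ k1 < m /\ m < 1.
Proof.
have : (2^-1 : R) `^ k1 < 1.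
  apply: (@lt_le_trans _ _ (1 `^ k1)); last by rewrite powR1.
  apply: gt0_ltr_powR; rewrite ?nnegrE ?invr_ge0//.
  by rewrite invf_lt1 ?ltr1n.
by rewrite /m => h; split; lra.
Qed.

Let m0 : 0 < m.
Proof. by rewrite divr_gt0// addr_gt0// powR_gt0. Qed.

(* Disjoint anisotropic rectangles of area comparable to [r k], on the k-th of
   which [psi] is O(r k `^ d). *)
Let Bx (eta : R) k : set (R2 R) :=
  `[eta * m * r k `^ k1, eta * r k `^ k1] `*` `[0, eta * r k `^ k2].

Let trivIset_Bx eta : 0 < eta -> trivIset setT (Bx eta).
Proof.
move=> eta0.
have lt (i j : nat) : (i < j)%N -> r j `^ k1 < m * r i `^ k1.
  move=> ij; have rij : r j <= 2^-1 * r i.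
    rewrite /r -exprS; apply: ler_wiXn2l => //; rewrite ?invr_ge0//.
    by rewrite invf_le1 ?ler1n.
  apply: (@le_lt_trans _ _ ((2^-1 * r i) `^ k1)).
    by apply: ge0_ler_powR; rewrite ?nnegrE ?(ltW k10) ?(ltW (r0 _))// mulr_ge0 ?invr_ge0// ltW.
  by rewrite powRM ?invr_ge0 ?(ltW (r0 _))// ltr_pM2r ?powR_gt0//; case: q1.
have dis (i j : nat) u : (i < j)%N -> Bx eta i u -> Bx eta j u -> False.
  move=> ij [/= + _] [/= + _]; rewrite !in_itv /= => /andP[h1 _] /andP[_ h2].
  have := le_trans h1 h2; rewrite -mulrA ler_pM2l// leNgt => /negP; apply.
  exact: lt.
move=> i j _ _ [u [ui uj]]; have [ij|ij|//] := ltngtP i j.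
  by case: (dis _ _ _ ij ui uj).
by case: (dis _ _ _ ij uj ui).
Qed.

Lemma exponent_gt_newton_distance : d < p.
Proof.
rewrite ltNge; apply/negP => pd.
have p0 : 0 < p by rewrite (lt_trans _ p1).
have [eta [c [eta0 c0 etaD avg]]] := patch_average hsigma hrho hrho0 Sx0 rhox0 rP D0 P0.
have [_ sP _ _ _] := rP.
have [C1 C10 dec] := weighted_decay spsi eta0 k10 k20 etaD dT.
have [M M0 PM] := box_bounded (ltW eta0) etaD sP.
have [delta [delta0 level]] := near_level.
(* This bounds [x - l x *: P u] for [x] in the test ball: [|P u| <= M] and [l x <= 2]. The same
   factor 2 appears in the width of the slabs [A k]. *)
pose K := `|(3 / 2) *: x0| + delta + 2 * M.
have K0 : 0 <= K by rewrite !addr_ge0 ?mulr_ge0// ltW.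
have [Cs Cs0 slabC] := slab_le abc0 K0.
pose a k := r k `^ (- (d / p)).
pose A k : set (mR3 R) := slab al be ga K (2 * C1 * r k `^ d).
pose B0 := Cs * (2 * C1).
have a0 k : 0 <= a k by exact: powR_ge0.
have mA k : measurable (A k) by exact: measurable_slab.
have B00 : 0 <= B0 by rewrite !mulr_ge0.
have aB k : ((a k `^ p)%:E * lebesgue3 R (A k) <= B0%:E)%E.
  apply: (@le_trans _ _ ((a k `^ p)%:E * (Cs * (2 * C1 * r k `^ d))%:E)%E).
    apply: lee_wpmul2l; first by rewrite lee_fin powR_ge0.
    by apply: slabC; rewrite !mulr_ge0 ?powR_ge0.
  rewrite -EFinM lee_fin /a -powRrM mulNr divfK ?gt_eqF//.
  have := powR_mulB (- d) 0 (r0 k); rewrite sub0r opprK powRr0 => E.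
  rewrite (_ : r k `^ (- d) * _ = B0 * (r k `^ (- d) * r k `^ d)); last first.
    by rewrite /B0; ring.
  by rewrite E mulr1.
have BxE k u : Bx eta k u -> `|u.1| <= eta * r k `^ k1 /\ `|u.2| <= eta * r k `^ k2.
  move=> [/=]; rewrite !in_itv /= => /andP[h1 h2] /andP[h3 h4].
  rewrite !ger0_norm//; apply: le_trans h1.
  by rewrite !mulr_ge0 ?powR_ge0// ltW.
have Bxeta k u : Bx eta k u -> `|u| <= eta.
  move=> /BxE[h1 h2]; rewrite norm_pair_le; apply/andP; split.
    exact: le_trans h1 (powR_le1_scale eta0 k10 (r01 k)).
  exact: le_trans h2 (powR_le1_scale eta0 k20 (r01 k)).
pose c2 := c * (eta ^+ 2 * (1 - m)).
have c20 : 0 < c2 by rewrite !mulr_gt0 ?exprn_gt0// subr_gt0; case: q1.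
pose G := ball ((3 / 2) *: x0) delta.
have lower N x : G x -> ((c2 * N%:R)%:E <=
    maximal_operator S sigma rho (stack a A N) x)%E.
  move=> Gx; have /andP[l1 l2] := level _ Gx.
  have l0 : 0 < l x by rewrite (lt_le_trans _ l1).
  apply: le_trans (avg (stack a A N) x (l x) N a (Bx eta) _ l0 a0 _ _ Bxeta (trivIset_Bx eta0) _).
  - have bx k : ((c2)%:E <= (c * a k)%:E * lebesgue2 R (Bx eta k))%E.
      rewrite lebesgue2_rect; last 2 first.
      + by rewrite -mulrA ler_pM2l// ler_piMl ?powR_ge0// ltW//; case: q1.
      + by rewrite mulr_ge0 ?powR_ge0// ltW.
      rewrite -EFinM lee_fin /c2.
      have -> : c * a k * ((eta * r k `^ k1 - eta * m * r k `^ k1) * (eta * r k `^ k2 - 0)) =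
        c * (eta ^+ 2 * (1 - m)) * (a k * (r k `^ k1 * r k `^ k2)) by ring.
      rewrite ler_peMr ?(ltW c20)//.
      have -> : r k `^ k1 * r k `^ k2 = r k `^ 1.
        by rewrite -(powR_mulB k1 1 (r0 k)) -k12 [k1 + k2]addrC addrK.
      rewrite /a -powRD; last by rewrite (gt_eqF (r0 k)) implybT.
      (* The height [a k] times the area, of order [r k], has exponent [1 - d / p <= 0] because
         [p <= d]; as [r k <= 1], every scale contributes at least [c2]. *)
      apply: (@le_trans _ _ (r k `^ 0)); first by rewrite powRr0.
      apply: ger_powR => //; have : 1 <= d / p by rewrite ler_pdivlMr ?mul1r.
      by rewrite addrC subr_le0.
    have -> : (c2 * N%:R)%:E = (\sum_(k < N) c2%:E)%E.
      by rewrite sumEFin sumr_const card_ord mulr_natr.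
    by apply: lee_sum => k _; exact: bx.
  - by move=> y; exact: stack_ge0.
  - by move=> k; apply: compact_setX; exact: segment_compact.
  - by move=> k; apply: measurableX; exact: measurable_itv.
  - move=> k u kN Bu; apply: (stack_ge _ kN).
    have [u1 u2] := BxE _ _ Bu.
    have Pu := PM _ (Bxeta _ _ Bu).
    have ly : `|l (x - l x *: P u)| <= 2 * C1 * r k `^ d.
      (* The choice of dilation cancels [l x], leaving [- l x * psi u], to which the decay on the
         box applies. *)
      rewrite lZB /l LP mulrDr mulr1 opprD addrA subrr sub0r normrN normrM -mulrA.
      by apply: ler_pM => //; [rewrite ger0_norm ?(ltW l0)|exact: dec].
    have nx : `|x - l x *: P u| <= K.
      apply: le_trans (ler_normB _ _) _; rewrite /K lerD//.
        rewrite -lerBlDl; apply: le_trans (lerB_dist _ _) _.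
        by rewrite distrC; move: Gx; rewrite /G -ball_normE /= => /ltW.
      by rewrite normrZ; apply: ler_pM => //; rewrite ger0_norm ?(ltW l0).
    move: nx; rewrite !norm_pair_le => /andP[/andP[n1 n2] n3].
    by split => //; rewrite -lE.
have [C HC] := hM.
have d0 : 0 < 2 * delta by rewrite mulr_gt0.
have [N HN] := @powR_superlinear R (c2 `^ p * (2 * delta) ^+ 3) (`|C| `^ p * B0) p
   (mulr_gt0 (powR_gt0 _ c20) (exprn_gt0 _ d0))
   (mulr_ge0 (powR_ge0 _ _) B00) p1.
have f0 x : 0 <= stack a A N x := stack_ge0 a A N x.
have mf := measurable_stack (T := mR3 R) a N mA.
have fB := integral_stack_le N p0 mA a0 aB.
have fL := Lfun_of_integral_le f0 mf fB.
have mG : measurable (G : set (mR3 R)) by apply: open_measurable3; exact: ball_open.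
have := Lnorm_le_measure (ltW p1) f0 fB (HC _ fL) mG (lebesgue3_ball _ (ltW delta0))
  (mulr_ge0 (ltW c20) (ler0n _ _)) (lower N).
rewrite powRM ?ler0n ?(ltW c20)// leNgt => /negP; apply.
by move: HN; rewrite mulrA [X in _ < X -> _]mulrAC [X in X < _ -> _]mulrAC -!mulrA.
Qed.

End height_test.

(** * The exponent p = 1 *)

(** The two points are joined by two axis-parallel legs. [MVT_line] locates its intermediate point
    only up to sign, within distance [2 * eta] of [v] in each coordinate, whence the larger box of
    size [3 * eta]. *)
Lemma box_lipschitz {R : realType} (D : set (R2 R)) (eta : R) (f : R2 R -> R) :
  0 <= eta -> (forall u, `|u| <= 3 * eta -> D u) -> smooth_on D f ->
  exists2 C, 0 <= C & forall u v : R2 R, `|u| <= eta -> `|v| <= eta ->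
    `|f u - f v| <= C * `|u - v|.
Proof.
move=> eta0 etaD sf.
have eta30 : 0 <= 3 * eta by rewrite mulr_ge0.
have dsm w : smooth_on D ('D_w f) by move=> k; have [_ /(_ w)[]] := sf k.+1.
have [M1 M10 B1] := box_bounded eta30 etaD (dsm (1, 0)).
have [M2 M20 B2] := box_bounded eta30 etaD (dsm (0, 1)).
have dv w u : `|u| <= 3 * eta -> derivable f u w.
  by move=> /etaD Du; have [_ /(_ w)[+ _]] := sf 1%N; apply.
exists (M1 + M2) => [|u v ue ve]; first exact: addr_ge0.
have : `|u - v| <= 2 * eta.
  by rewrite (le_trans (ler_normB _ _))// mulrDl mul1r lerD.
rewrite norm_pair_le /= => /andP[e1 e2].
move: (ve); rewrite norm_pair_le => /andP[v1 v2].
have in3 (s t : R) : `|s| <= `|u.1 - v.1| -> `|t| <= `|u.2 - v.2| ->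
    `|v + (s, t)| <= 3 * eta.
  move=> sh th; rewrite (le_trans (ler_normD _ _))//.
  have -> : 3 * eta = eta + 2 * eta by ring.
  rewrite lerD// norm_pair_le /=.
  by rewrite (le_trans sh)// (le_trans th).
have n0 (z : R) : `|0 : R| <= `|z| by rewrite normr0.
have E1 s : v + s *: (1, 0) = v + (s, 0) :> R2 R.
  by congr (_ + _); congr pair; rewrite /= /GRing.scale /=; ring.
have E2 s : v + (u.1 - v.1, 0) + s *: (0, 1) = v + (u.1 - v.1, s) :> R2 R.
  by rewrite -addrA; congr (_ + _); congr pair; rewrite /= /GRing.scale /=; ring.
have [|s sh F1] := @MVT_line R (R2 R) f v (1, 0) (u.1 - v.1).
  by move=> s sh; apply: dv; rewrite E1; exact: in3.
have [|t th F2] := @MVT_line R (R2 R) f (v + (u.1 - v.1, 0)) (0, 1) (u.2 - v.2).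
  by move=> t th; apply: dv; rewrite E2; exact: in3.
have Eu : v + (u.1 - v.1, u.2 - v.2) = u.
  by case: (u) (v) => [? ?] [? ?]; congr pair => /=; ring.
move: F1 F2; rewrite !E1 !E2 Eu => F1 F2.
have -> : f u - f v = (u.2 - v.2) * 'D_((0, 1) : R2 R) f (v + (u.1 - v.1, t)) +
    (u.1 - v.1) * 'D_((1, 0) : R2 R) f (v + (s, 0)) by rewrite -F1 -F2 subrKA.
have [d1 d2] : `|(u - v).1| <= `|u - v| /\ `|(u - v).2| <= `|u - v|.
  by apply/andP; rewrite -norm_pair_le.
rewrite (le_trans (ler_normD _ _))// [leRHS]mulrDl addrC !normrM.
by rewrite lerD// mulrC ler_pM//; [apply: B1|apply: B2]; apply: in3.
Qed.

Section endpoint_test.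
Context {R : realType} (S : set (R3 R))
  (sigma : {measure set (mR3 R) -> \bar R}) (rho : R3 R -> R)
  (hsigma : is_surface_measure S sigma)
  (hrho : smooth_compactly_supported S rho)
  (hrho0 : forall y, S y -> 0 <= rho y)
  (x0 : R3 R) (Sx0 : S x0) (rhox0 : rho x0 != 0)
  (D : set (R2 R)) (P : R2 R -> R3 R)
  (rP : regular_patch S D P) (D0 : D 0) (P0 : P 0 = x0)
  (L : {linear R3 R -> R3 R}) (Linj : injective L) (phi : R2 R -> R)
  (LP : forall u, L (P u) = (u, 1 + phi u)) (Lx0 : L x0 = (0, 0, 1))
  (sphi : smooth_on D phi) (phi0 : phi 0 = 0).

Let oD : open D. Proof. by case: rP. Qed.

(* Dilates of the patch sweep out a neighbourhood of [x0]. *)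
Lemma cone_neighborhood (eps : R) : 0 < eps -> exists2 delta : R, 0 < delta &
  forall x, ball x0 delta x -> exists t u, [/\ 0 < t, t <= 2, `|u| <= eps & x = t *: P u].
Proof.
move=> eps0.
have cphi : {for 0, continuous phi} by exact: (sphi 0%N).1.
have nphi : \forall u \near (0 : R2 R), `|phi 0 - phi u| < 1 / 4.
  by move/cvgrPdist_lt : cphi => /(_ (1 / 4)); rewrite divr_gt0//; exact.
have nD : \forall u \near (0 : R2 R), D u by exact: open_nbhs_nbhs.
have /nbhs_ballP[e1 /= e10 He1] : nbhs (0 : R2 R)
    ([set u | `|phi 0 - phi u| < 1 / 4] `&` D) by exact: filterI.
pose e := Num.min (e1 / 4) (eps / 2).
have e0 : 0 < e by rewrite lt_min !divr_gt0.
have small (z : R2 R) (t : R) : `|z| < e -> 1 / 2 <= t ->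
    [/\ `|t^-1 *: z| <= eps, `|phi (t^-1 *: z)| < 1 / 4 & D (t^-1 *: z)].
  rewrite lt_min => /andP[z1 z2] t2; have t0 : 0 < t by lra.
  have tz : `|t^-1 *: z| <= 2 * `|z|.
    rewrite normrZ ler_wpM2r// ger0_norm ?invr_ge0 ?(ltW t0)//.
    by rewrite -[leRHS]invrK lef_pV2 ?posrE ?invr_gt0//; lra.
  have [h1 h2] : ([set u | `|phi 0 - phi u| < 1 / 4] `&` D) (t^-1 *: z).
    apply: He1; rewrite -ball_normE /= sub0r normrN (le_lt_trans tz)//; lra.
  split => //; first by rewrite (le_trans tz)//; lra.
  by move: h1; rewrite /= phi0 sub0r normrN.
have cL : {for x0, continuous L} by exact: continuous_linear3_map.
have nL : \forall x \near x0, `|L x0 - L x| < Num.min e (1 / 4).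
  by move/cvgrPdist_lt : cL => /(_ (Num.min e (1 / 4))); rewrite lt_min e0 divr_gt0//; exact.
have [delta /= delta0 Hd] := (nbhs_ballP _ _).1 nL.
exists delta => // x /Hd /=; rewrite Lx0 lt_min => /andP[].
rewrite !norm_pair_lt /= => /andP[/andP[z1 z2] _] /andP[_ z3].
pose z := (L x).1.
have ze : `|z| < e.
  by rewrite norm_pair_lt; move: z1 z2; rewrite !sub0r !normrN => -> ->.
move: z3; rewrite ltr_distlC => /andP[z3 z4].
(* A solution of [g t = (L x).2] gives [x = t *: P (t^-1 *: z)]. With [|phi| < 1 / 4], the value at
   [1 / 2] is at most [3 / 4] and that at 2 at least [5 / 4], while [(L x).2] lies between, so the
   intermediate value theorem applies. *)
pose g t := t * (1 + phi (t^-1 *: z)).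
have cg : {within `[1 / 2, 2], continuous g}.
  apply: continuous_in_subspaceT => t /set_mem /=; rewrite in_itv /= => /andP[t1 t2].
  have t0 : t != 0 by rewrite gt_eqF//; lra.
  have [_ _ Dt] := small _ _ ze t1.
  apply: cvgM; first exact: cvg_id.
  apply: cvgD; first exact: cvg_cst.
  have cz : (fun t : R => t^-1 *: z) @ t --> t^-1 *: z.
    by apply: cvgZr_tmp; apply: cvgV.
  by apply: (cvg_comp _ _ cz); exact: ((sphi 0%N).1 _ Dt).
have g1 : g (1 / 2) <= 3 / 4.
  by have [_ + _] := small z (1 / 2) ze (lexx _); rewrite ltr_norml /g => /andP[? ?]; lra.
have g2 : 5 / 4 <= g 2.
  have h : 1 / 2 <= 2 :> R by lra.
  by have [_ + _] := small z 2 ze h; rewrite ltr_norml /g => /andP[? ?]; lra.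
have [||t] := @IVT R g (1 / 2) 2 (L x).2 _ cg; first lra.
  by rewrite ge_min le_max; apply/andP; split; apply/orP; [left|right]; lra.
rewrite in_itv /= => /andP[t1 t2] gt.
exists t, (t^-1 *: z); split => //; first lra; first by have [] := small _ _ ze t1.
apply: Linj; rewrite linearZ LP.
have t0 : t != 0 by rewrite gt_eqF//; lra.
rewrite [LHS]surjective_pairing -gt -/z.
by congr pair; rewrite /= scalerA divff ?scale1r.
Qed.

(** For [x = t *: P u], the point [x - t *: P v] is [t *: (P u - P v)], hence in the ball of radius
    [s] as soon as [v] is within a multiple of [s] of [u]. The average is thus at least of order
    [s^2] on a ball independent of [s], against an [L^1] norm of order [s^3]. *)
Lemma not_bounded_L1 : ~ maximal_operator_bounded S sigma rho 1%:E.
Proof.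
move=> [C HC].
have [eta [c [eta0 c0 etaD avg]]] := patch_average hsigma hrho hrho0 Sx0 rhox0 rP D0 P0.
have [_ sP _ _ _] := rP.
pose e := eta / 3; have e0 : 0 < e by rewrite divr_gt0.
have eD u : `|u| <= 3 * e -> D u by move=> h; apply: etaD; move: h; rewrite /e; lra.
have s1 : smooth_on D (fun u => (P u).1).
  by move=> k; apply: (Ck_on_linear_comp oD _ (sP k) (L := fst)) => y; exact: cvg_fst.
have [l1 l10 H1] : exists2 C, 0 <= C & forall u v : R2 R, `|u| <= e -> `|v| <= e ->
    `|(P u).1.1 - (P v).1.1| <= C * `|u - v|.
  apply: (box_lipschitz (ltW e0) eD).
  by move=> k; apply: (Ck_on_linear_comp oD _ (s1 k) (L := fst)) => y; exact: cvg_fst.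
have [l2 l20 H2] : exists2 C, 0 <= C & forall u v : R2 R, `|u| <= e -> `|v| <= e ->
    `|(P u).1.2 - (P v).1.2| <= C * `|u - v|.
  apply: (box_lipschitz (ltW e0) eD).
  by move=> k; apply: (Ck_on_linear_comp oD _ (s1 k) (L := snd)) => y; exact: cvg_snd.
have [l3 l30 H3] : exists2 C, 0 <= C & forall u v : R2 R, `|u| <= e -> `|v| <= e ->
    `|(P u).2 - (P v).2| <= C * `|u - v|.
  apply: (box_lipschitz (ltW e0) eD).
  by move=> k; apply: (Ck_on_linear_comp oD _ (sP k) (L := snd)) => y; exact: cvg_snd.
pose La := l1 + l2 + l3 + 1.
have La0 : 0 < La by rewrite /La; lra.
have Lip u v : `|u| <= e -> `|v| <= e -> `|P u - P v| <= La * `|u - v|.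
  move=> ue ve; have n := normr_ge0 (u - v).
  rewrite !norm_pair_le /= (le_trans (H1 _ _ ue ve)) ?(le_trans (H2 _ _ ue ve))
    ?(le_trans (H3 _ _ ue ve))// ler_wpM2r// /La; lra.
have e20 : 0 < e / 2 by rewrite divr_gt0.
have [delta delta0 cone] := cone_neighborhood e20.
have key (s : R) : 0 < s -> s <= 2 * e * La ->
    c * (s / (2 * La)) ^+ 2 * (2 * delta) ^+ 3 <= `|C| * (2 * s) ^+ 3.
  move=> s0 sLa.
  pose B : set (mR3 R) := ball (0 : R3 R) s.
  have mB : measurable B by apply: open_measurable3; exact: ball_open.
  pose f : mR3 R -> R := \1_B.
  have f0 x : 0 <= f x by [].
  have mf : measurable_fun setT f by exact: measurable_indic.
  have fB : (\int[lebesgue3 R]_x (f x `^ 1)%:E <= ((2 * s) ^+ 3)%:E)%E.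
    rewrite (_ : (\int[_]_x _)%E = (\int[lebesgue3 R]_x (\1_B x)%:E)%E); last first.
      by apply: eq_integral => x _; rewrite powRr1.
    by rewrite integral_indic// setIT lebesgue3_ball// ltW.
  have fL := Lfun_of_integral_le f0 mf fB.
  have mG : measurable (ball x0 delta : set (mR3 R)).
    by apply: open_measurable3; exact: ball_open.
  (* Since [t <= 2], moving [v] by at most [w] displaces [t *: P v] by at most
     [2 * La * w = s / 2 < s]; the square of such [v] has side [s / (2 * La)]. *)
  pose w := s / (4 * La); have w0 : 0 < w by rewrite divr_gt0// mulr_gt0.
  have we : w <= e / 2 by rewrite /w ler_pdivrMr ?mulr_gt0//; lra.
  have lower x : ball x0 delta x -> ((c * (s / (2 * La)) ^+ 2)%:E <=
      maximal_operator S sigma rho f x)%E.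
    move=> /cone[t [u [t0 t2 ue ->]]].
    pose A k : set (R2 R) := if k is 0%N then
      `[u.1 - w, u.1 + w] `*` `[u.2 - w, u.2 + w] else set0.
    have Aw k v : A k v -> `|v - u| <= w.
      case: k => [|//] [/=]; rewrite !in_itv /= -!ler_distl => h1 h2.
      by rewrite norm_pair_le /= h1 h2.
    have Ae k v : A k v -> `|v| <= e.
      move=> /Aw vw; rewrite -[v](subrK u) (le_trans (ler_normD _ _))//; lra.
    have := avg f (t *: P u) t 1%N (fun=> 1) A f0 t0.
    rewrite big_ord1 mulr1 lebesgue2_rect; [|lra|lra].
    rewrite -EFinM (_ : c * _ = c * (s / (2 * La)) ^+ 2); last first.
      by rewrite /w; field; rewrite gt_eqF.
    apply => //.
    - by case=> [|k]; [apply: compact_setX; exact: segment_compact|exact: compact0].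
    - case=> [|k]; last exact: measurable0.
      by apply: measurableX; exact: measurable_itv.
    - by move=> k v /Ae; rewrite /e; lra.
    - by move=> [|i] [|j] _ _ //= [x0' []].
    - move=> k v _ Av; rewrite /f indicE mem_set// /B -ball_normE /= sub0r normrN.
      rewrite -scalerBr normrZ ger0_norm ?(ltW t0)//.
      have h : `|P u - P v| <= La * w.
        apply: le_trans (Lip _ _ _ (Ae _ _ Av)) _; first by lra.
        by rewrite ler_pM2l// distrC; exact: Aw Av.
      apply: (@le_lt_trans _ _ (2 * (La * w))); first exact: ler_pM (ltW t0) _ t2 h.
      by rewrite (_ : 2 * (La * w) = s / 2); [lra|rewrite /w; field; rewrite gt_eqF].
  have a0 : 0 <= c * (s / (2 * La)) ^+ 2 by rewrite mulr_ge0 ?(ltW c0)// sqr_ge0.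
  have := Lnorm_le_measure (lexx 1) f0 fB (HC _ fL) mG (lebesgue3_ball _ (ltW delta0))
    a0 lower.
  by rewrite !powRr1.
pose q := c * (1 / (2 * La)) ^+ 2 * (2 * delta) ^+ 3.
have La2 : 0 < 2 * La by rewrite mulr_gt0.
have delta2 : 0 < 2 * delta by rewrite mulr_gt0.
have q0 : 0 < q by rewrite /q !mulr_gt0// ?invr_gt0.
(* The second bound gives [8 * |C| * s < q], which contradicts [key] after division by [s^2]; the
   added 1 covers [C = 0]. *)
pose s := Num.min (2 * e * La) (q / (8 * (`|C| + 1))).
have C1 : 0 < 8 * (`|C| + 1) by rewrite mulr_gt0// ltr_wpDl.
have s0 : 0 < s by rewrite lt_min divr_gt0// andbT !mulr_gt0.
have := key s s0; rewrite /s ge_min lexx -/s => /(_ isT).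
have -> : c * (s / (2 * La)) ^+ 2 * (2 * delta) ^+ 3 = q * s ^+ 2.
  by rewrite /q; field; rewrite gt_eqF.
have -> : `|C| * (2 * s) ^+ 3 = (8 * `|C| * s) * s ^+ 2 by ring.
rewrite ler_pM2r ?exprn_gt0// leNgt => /negP; apply.
have : s <= q / (8 * (`|C| + 1)) by rewrite ge_min lexx orbT.
rewrite ler_pdivlMr// => h; nra.
Qed.

End endpoint_test.

(** * Order of vanishing in local coordinates, and conclusion *)

Lemma smooth_on_id {R : realType} {V : normedModType R} (D : set V) :
  smooth_on D (id : V -> V).
Proof.
case=> [|k]; first by split => // x _; exact: cvg_id.
split => [x _|v]; first exact: cvg_id.
split => [x _|]; first exact: derivable_id.
have -> : 'D_v (id : V -> V) = cst v by apply/funext => x; rewrite derive_id.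
exact: Ck_on_cst.
Qed.

Lemma local_coordinates_id {R : realType} : local_coordinates (id : R2 R -> R2 R).
Proof.
split => //; exists setT, setT, id.
by split; try (by split; [exact: openT|]); try (by split; exact: smooth_on_id).
Qed.

(** The value and, by the chain rule, the gradient at the origin vanish in every local coordinate
    system. This bounds all Newton distances below by 1. *)
Lemma taylor_support_ge2 {R : realType} (Omega : set (R2 R)) (phi : R2 R -> R)
    (Psi : R2 R -> R2 R) :
  open Omega -> Omega 0 -> smooth_on Omega phi -> phi 0 = 0 ->
  (forall v : R2 R, 'D_v phi 0 = 0) -> local_coordinates Psi ->
  forall a, taylor_support (phi \o Psi) a -> (2 <= a.1 + a.2)%N.
Proof.
move=> oO O0 sphi phi0 dphi0 [Psi0 [U [W [Phi [[oU U0] _ [sPsi _] _ _]]]]] a.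
have D1 v : 'D_v (phi \o Psi) 0 = 0.
  have [_ /(_ v)[dPsi _]] := sPsi 1%N.
  have dphi : differentiable phi (Psi 0).
    by rewrite Psi0; exact: C1_differentiable oO O0 (sphi 1%N).
  have [_ ->] := is_derive_comp (dPsi _ U0) dphi.
  by rewrite -(deriveE _ dphi) Psi0.
case: a => -[|[|a]] [|[|b]] //; rewrite /taylor_support /taylor_coef /=.
- by rewrite Psi0 phi0 mul0r eqxx.
- by rewrite D1 mul0r eqxx.
- by rewrite D1 mul0r eqxx.
Qed.


Theorem theorem1p3 (R : realType) (S : set (R3 R))
    (sigma : {measure set (mR3 R) -> \bar R}) (rho : R3 R -> R) (p : \bar R)
    (hS : smooth_hypersurface S) (hT : transversality S)
    (hsigma : is_surface_measure S sigma)
    (hrho : smooth_compactly_supported S rho)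
    (hrho0 : forall y, S y -> 0 <= rho y)
    (hp : (1 <= p)%E)
    (hM : maximal_operator_bounded S sigma rho p) :
  forall (x0 : R3 R) (h : \bar R), S x0 -> is_height_at S x0 h ->
    (h < 2%:E)%E -> rho x0 != 0 -> (h < p)%E.
Proof.
move=> x0 _ Sx0 [L [Om [phi [LN _ ->]]]] h2 rhox0; rewrite ltNge; apply/negP => ph.
have [[bL Lx0] [oO O0] sphi [phi0 dphi0] _] := LN.
have T2 := taylor_support_ge2 oO O0 sphi phi0 dphi0.
case: p hp hM ph => [r r1 hM rh|_ _ yh|//]; last first.
  by have := le_lt_trans yh h2; rewrite ltNge leey.
case hE : (height phi) => [d| |]; [|by rewrite hE in h2|by rewrite hE in rh].
rewrite hE !lee_fin !lte_fin in r1 rh h2.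
(* At [p = 1] the bound fails whatever the height, so the given coordinates serve; for [p > 1] the
   patch is taken in coordinates where the height is attained. *)
move: r1; rewrite le_eqVlt => /orP[/eqP r1|r1].
  have [D [P [[oD D0] [_ sphiD] rP P0 LP]]] := patch_exists LN local_coordinates_id.
  rewrite -r1 in hM.
  exact: (not_bounded_L1 hsigma hrho hrho0 Sx0 rhox0 rP D0 P0 (bij_inj bL) LP Lx0).
have [Psi LC dN] := height_attained T2 hE h2.
have [D [P [[oD D0] [_ spsi] rP P0 LP]]] := patch_exists LN LC.
have [[k1 [k2 [k10 k20 k12 dT]]] _] := newton_distance_weights (T2 _ LC) dN h2.
have LP2 u : (L (P u)).2 = 1 + (phi \o Psi) u by rewrite LP.
have Lx02 : (L x0).2 = 1 by rewrite Lx0.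
have := exponent_gt_newton_distance hsigma hrho hrho0 Sx0 rhox0 rP D0 P0 LP2 Lx02
  spsi k10 k20 k12 dT r1 hM.
by rewrite ltNge rh.
Qed.
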